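(* Let $G$ be a hyperbolic group whose abelianisation has torsion-free rank at least $2$. Then $\mathcal{DP}(G,\mathrm{ab})$, the Diophantine Problem in $G$ with abelianisation constraints, is undecidable.
   Context: ''Hyperbolic'' means word-hyperbolic in the sense of Gromov. The torsion-free rank of $G^{\mathrm{ab}}=G/G'$ is the integer $m$ such that $G^{\mathrm{ab}}\cong\mathbb{Z}^m\times(\text{finite group})$. **Equations.** Let $G$ be a group with a finite generating set. A finite system of equations in $G$ over variables $\mathbf{x}=\{X_1,\dots,X_k\}$ is a finite subset $\mathcal{E}=\{w_1,\dots,w_n\}$ of the free product $G\ast F(\mathbf{x})$; constants from $G$ are given as words over the fixed generators and their inverses. A solution is a homomorphism $\phi:G\ast F(\mathbf{x})\to G$ which is the identity on $G$ and satisfies $\phi(w_1)=\dots=\phi(w_n)=1$. **The problem $\mathcal{DP}(G,\mathrm{ab})$.** Let $\mathrm{ab}:G\to G^{\mathrm{ab}}=G/G'$ be the abelianisation map. An instance of $\mathcal{DP}(G,\mathrm{ab})$ consists of a finite system $\mathcal{E}$ of equations in $G$ on variables $X_1,\dots,X_k$ together with a finite system $\Theta$ of equations in the group $G^{\mathrm{ab}}$ on the same variables. The question is whether $\mathcal{E}$ has a solution $(g_1,\dots,g_k)\in G^k$ such that $(\mathrm{ab}(g_1),\dots,\mathrm{ab}(g_k))$ satisfies $\Theta$ in $G^{\mathrm{ab}}$. The problem is decidable if there is an algorithm answering this question for every instance, and undecidable otherwise. *)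

(* Defs.v *)
From HB Require Import structures.
From mathcomp Require Import all_boot all_order all_algebra.
From mathcomp Require Import fingroup generic_quotient boolp.

Set Implicit Arguments.
Unset Strict Implicit.
Unset Printing Implicit Defensive.

Import Order.TTheory GRing.Theory Num.Theory.

Local Open Scope quotient_scope.

(** [(a, false)] is the letter [a] and [(a, true)] its formal inverse. *)
Definition word (A : Type) : Type := seq (A * bool).

Definition eval_word (A : Type) (H : groupType) (v : A -> H) (w : word A) : H :=
  (\prod_(l <- w) (if l.2 then (v l.1)^-1 else v l.1))%g.

Definition generates (G : groupType) (n : nat) (s : n.-tuple G) : Prop :=
  forall g : G, exists w : word 'I_n, eval_word (tnth s) w = g.

Definition has_word (G : groupType) (n : nat) (s : n.-tuple G) (g : G)
    (l : nat) : bool :=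
  [exists w : l.-tuple ('I_n * bool), eval_word (tnth s) w == g].

Lemma has_word_ex (G : groupType) (n : nat) (s : n.-tuple G) :
  generates s -> forall g, exists l, has_word s g l.
Proof.
move=> gen g; have [w <-] := gen g; exists (size w).
by apply/existsP; exists (in_tuple w).
Qed.

Definition word_length (G : groupType) (n : nat) (s : n.-tuple G)
    (gen : generates s) (g : G) : nat :=
  ex_minn (has_word_ex gen g).

Definition word_dist (G : groupType) (n : nat) (s : n.-tuple G)
    (gen : generates s) (x y : G) : nat :=
  word_length gen (x^-1 * y)%g.

Definition gromov_product (T : Type) (d : T -> T -> nat) (w x y : T) : rat :=
  (((d x w)%:R + (d y w)%:R - (d x y)%:R) / 2%:R)%R.

(** A rational constant [delta] is no restriction: any real one may be
    enlarged. *)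
Definition gromov_hyperbolic (T : Type) (d : T -> T -> nat) : Prop :=
  exists delta : rat, (0 <= delta)%R /\
    forall w x y z : T,
      (Num.min (gromov_product d w x y) (gromov_product d w y z) - delta
         <= gromov_product d w x z)%R.

Definition hyperbolic (G : groupType) : Prop :=
  exists (n : nat) (s : n.-tuple G) (gen : generates s),
    gromov_hyperbolic (word_dist gen).

Inductive derived (G : groupType) : G -> Prop :=
| derived1 : derived 1%g
| derivedR x y : derived [~ x, y]%g
| derivedM x y : derived x -> derived y -> derived (x * y)%g
| derivedV x : derived x -> derived (x^-1)%g.

Lemma derivedJ (G : groupType) (x y : G) : derived x -> derived (x ^ y)%g.
Proof.
move=> dx; have -> : (x ^ y = x * [~ x, y])%g by rewrite commgEl mulVKg.
by apply: derivedM => //; apply: derivedR.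
Qed.

Definition ab_rel (G : groupType) (x y : G) : bool :=
  `[< derived (x^-1 * y)%g >].

Lemma ab_rel_refl (G : groupType) : reflexive (@ab_rel G).
Proof. by move=> x; apply/asboolP; rewrite mulVg; apply: derived1. Qed.

Lemma ab_rel_sym (G : groupType) : symmetric (@ab_rel G).
Proof.
suff h (x y : G) : ab_rel x y -> ab_rel y x by move=> x y; apply/idP/idP; apply: h.
by move=> /asboolP/derivedV; rewrite invgM invgK => ?; apply/asboolP.
Qed.

Lemma ab_rel_trans (G : groupType) : transitive (@ab_rel G).
Proof.
move=> y x z /asboolP dxy /asboolP dyz; apply/asboolP.
by have := derivedM dxy dyz; rewrite -mulgA mulVKg.
Qed.

Canonical ab_equiv (G : groupType) : equiv_rel G :=
  EquivRel (@ab_rel G) (@ab_rel_refl G) (@ab_rel_sym G) (@ab_rel_trans G).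

Definition abelianization (G : groupType) : Type := {eq_quot (ab_equiv G)}.

HB.instance Definition _ (G : groupType) :=
  Choice.copy (abelianization G) {eq_quot (ab_equiv G)}.

Definition ab (G : groupType) (x : G) : abelianization G :=
  (\pi_({eq_quot (ab_equiv G)}) x)%qT.

Definition ab_repr (G : groupType) (a : abelianization G) : G :=
  repr (a : {eq_quot (ab_equiv G)}).

Lemma ab_reprK (G : groupType) : cancel (@ab_repr G) (@ab G).
Proof. by move=> a; apply: reprK. Qed.

Lemma abP (G : groupType) (x y : G) : ab x = ab y <-> derived (x^-1 * y)%g.
Proof.
split=> [/eqP|d]; first by rewrite /ab eqmodE => /asboolP.
by apply/eqP; rewrite /ab eqmodE; apply/asboolP.
Qed.

Definition ab_mul (G : groupType) (a b : abelianization G) : abelianization G :=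
  ab (ab_repr a * ab_repr b)%g.

Definition ab_inv (G : groupType) (a : abelianization G) : abelianization G :=
  ab (ab_repr a)^-1%g.

Lemma ab_mulE (G : groupType) (x y : G) : ab_mul (ab x) (ab y) = ab (x * y)%g.
Proof.
apply/abP; have /abP dx := ab_reprK (ab x); have /abP dy := ab_reprK (ab y).
move: (ab_repr _) dx (ab_repr _) dy => x' dx y' dy.
have -> : ((x' * y')^-1 * (x * y) = (x'^-1 * x) ^ y' * (y'^-1 * y))%g.
  by rewrite /conjg invgM !mulgA mulgK.
by apply: derivedM => //; apply: derivedJ.
Qed.

Lemma ab_invE (G : groupType) (x : G) : ab_inv (ab x) = ab x^-1%g.
Proof.
apply/abP; have /abP /derivedV dx := ab_reprK (ab x).
move: (ab_repr _) dx => x' dx; rewrite invgK.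
suff -> : (x' / x = ((x'^-1 * x)^-1) ^ x^-1)%g by apply: derivedJ.
by rewrite /conjg invgM !invgK !mulgA mulgV mul1g.
Qed.

Lemma ab_mulA (G : groupType) : associative (@ab_mul G).
Proof.
move=> a b c; rewrite -(ab_reprK a) -(ab_reprK b) -(ab_reprK c).
by rewrite !ab_mulE mulgA.
Qed.

Lemma ab_mul1 (G : groupType) : left_id (ab 1%g) (@ab_mul G).
Proof. by move=> a; rewrite -(ab_reprK a) ab_mulE mul1g. Qed.

Lemma ab_mulr1 (G : groupType) : right_id (ab 1%g) (@ab_mul G).
Proof. by move=> a; rewrite -(ab_reprK a) ab_mulE mulg1. Qed.

Lemma ab_mulV (G : groupType) : left_inverse (ab 1%g) (@ab_inv G) (@ab_mul G).
Proof. by move=> a; rewrite -(ab_reprK a) ab_invE ab_mulE mulVg. Qed.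

Lemma ab_mulrV (G : groupType) : right_inverse (ab 1%g) (@ab_inv G) (@ab_mul G).
Proof. by move=> a; rewrite -(ab_reprK a) ab_invE ab_mulE mulgV. Qed.

HB.instance Definition _ (G : groupType) :=
  isGroup.Build (abelianization G) (@ab_mulA G) (@ab_mul1 G) (@ab_mulr1 G)
    (@ab_mulV G) (@ab_mulrV G).

(** [abelianization G] is written multiplicatively and Z^m additively, so the
    isomorphism onto Z^m x A is spelled out. *)
Definition torsion_free_rank (G : groupType) (m : nat) : Prop :=
  exists (A : finGroupType) (f : abelianization G -> 'rV[int]_m * A),
    bijective f /\
    forall x y, f (x * y)%g = (((f x).1 + (f y).1)%R, ((f x).2 * (f y).2)%g).

(** An equation over [n] constants and [k] variables: a word representing an
    element of the free product of the group with the free group on the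
    variables. *)
Definition equation (n k : nat) : Type := word ('I_n + 'I_k)%type.

(** The homomorphisms from the free product which are the identity on the group
    correspond to the assignments [x] of the variables; this is the value at
    [w] of the one attached to [x], the constants being interpreted by [c]. *)
Definition eval_equation (H : groupType) (n k : nat) (c : 'I_n -> H)
    (x : 'I_k -> H) (w : equation n k) : H :=
  eval_word (fun a => match a with inl i => c i | inr j => x j end) w.

Definition solves (H : groupType) (n k : nat) (c : 'I_n -> H) (x : 'I_k -> H)
    (E : seq (equation n k)) : Prop :=
  forall w, w \in E -> eval_equation c x w = 1%g.

Record dp_instance (n : nat) := DPInstance {
  dp_nvars : nat;
  dp_eqs : seq (equation n dp_nvars);
  dp_ab_eqs : seq (equation n dp_nvars)
}.

(** Constants in the abelianisation are words over the images of the generators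
    [s] of [G]. *)
Definition dp_ab (G : groupType) (n : nat) (s : n.-tuple G)
    (I : dp_instance n) : Prop :=
  exists g : (dp_nvars I).-tuple G,
    solves (tnth s) (tnth g) (dp_eqs I) /\
    solves (fun i => ab (tnth s i)) (fun j => ab (tnth g j)) (dp_ab_eqs I).

Inductive recalg : nat -> Type :=
| ra_zero n : recalg n
| ra_succ : recalg 1
| ra_proj n (i : 'I_n) : recalg n
| ra_comp n k (f : recalg k) (g : 'I_k -> recalg n) : recalg n
| ra_rec n (f : recalg n) (g : recalg n.+2) : recalg n.+1
| ra_mu n (f : recalg n.+1) : recalg n.

Fixpoint prim_rec (base : nat -> Prop) (step : nat -> nat -> nat -> Prop)
    (i y : nat) : Prop :=
  if i is j.+1 then exists z, prim_rec base step j z /\ step j z y else base y.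

(** [ra_eval f v y]: the computation of [f] on the arguments [v] terminates with
    value [y].  The recursion argument of [ra_rec] and the unknown of [ra_mu]
    come first. *)
Fixpoint ra_eval (n : nat) (f : recalg n) : n.-tuple nat -> nat -> Prop :=
  match f in recalg n return n.-tuple nat -> nat -> Prop with
  | ra_zero _ => fun v y => y = 0
  | ra_succ => fun v y => y = (thead v).+1
  | ra_proj _ i => fun v y => y = tnth v i
  | ra_comp _ k f g => fun v y =>
      exists w : k.-tuple nat,
        (forall i, ra_eval (g i) v (tnth w i)) /\ ra_eval f w y
  | ra_rec _ f g => fun v y =>
      prim_rec (ra_eval f (behead_tuple v))
        (fun j z => ra_eval g [tuple of j :: z :: behead_tuple v]) (thead v) y
  | ra_mu _ f => fun v y =>
      ra_eval f [tuple of y :: v] 0 /\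
      forall z, z < y -> exists u, ra_eval f [tuple of z :: v] u.+1
  end.

(** [code] is a Goedel numbering; nothing is required of the algorithm on
    numbers which are not codes. *)
Definition decidable_problem (I : Type) (code : I -> nat) (P : I -> Prop) :
    Prop :=
  exists p : recalg 1, forall i : I,
    (P i -> ra_eval p [tuple code i] 1) /\ (~ P i -> ra_eval p [tuple code i] 0).

(** [CodeSeq.code] is a computable bijection from [seq nat] to [nat]. *)
Definition letter_code (n k : nat) (l : ('I_n + 'I_k) * bool) : nat :=
  match l.1 with
  | inl i => CodeSeq.code [:: 0; val i; nat_of_bool l.2]
  | inr j => CodeSeq.code [:: 1; val j; nat_of_bool l.2]
  end.

Definition system_code (n k : nat) (E : seq (equation n k)) : nat :=
  CodeSeq.code [seq CodeSeq.code [seq letter_code l | l <- w] | w : equation n k <- E].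

Definition instance_code (n : nat) (I : dp_instance n) : nat :=
  CodeSeq.code [:: dp_nvars I; system_code (dp_eqs I); system_code (dp_ab_eqs I)].

Definition dp_ab_decidable (G : groupType) (n : nat) (s : n.-tuple G) : Prop :=
  decidable_problem (@instance_code n) (dp_ab s).

(* Main.v *)
(** Two commuting elements of a hyperbolic group never generate Z^2.  Fix
    [phi : G -> Z^2] with [phi a = (1, 0)] and [phi b = (0, 1)].  If
    [phi u <> 0], the image of the centraliser of [u] lies on the line through
    [phi u].  So the elements [X] commuting with [b] encode the integers
    [phi2 X], the abelianisation constraints give addition, and the product of
    [k] and [l] is read off an element [W] commuting with [a * X], where [X]
    encodes [k]: [phi W] is a multiple of [(1, k)], and [phi1 W = l] is a linear
    constraint.  Every Diophantine system over the integers thus becomes an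
    instance of the problem.

    A decision procedure would be a recursive function [f].  By the theorem of
    Matiyasevich, Robinson, Davis and Putnam its graph is Diophantine, hence so
    is the statement "[f] rejects the system with code [(K, R, T)] whose three
    numerals are set to [K], [R] and [T]".  Substituting the code of an instance
    expressing that statement is contradictory. *)

Require Import Defs.
From HB Require Import structures.
From mathcomp Require Import all_boot all_order all_algebra.
From mathcomp Require Import boolp zify ring lra.

Set Implicit Arguments.
Unset Strict Implicit.
Unset Printing Implicit Defensive.
Import Order.TTheory GRing.Theory Num.Theory.

(** * Abelian subgroups of hyperbolic groups *)

(** The exclusion of Z^2 uses only an integer length function with the four-point inequality,
    discrete geodesics and finite balls. A finite part of the supposed Z^2 is conjugated so that its
    joint displacement is minimal; minimality forces some member to be nearly additive, and its
    powers then trace an axis.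

    Two obstacles shape the rest. The integers carried by centralisers may be negative, while
    Diophantine predicates range over natural numbers: each variable is therefore replaced by a sum
    of four squares. And nothing is shown about the computability of the translation of polynomials
    into group equations: it is carried out once, for one fixed polynomial equation. Only three
    numerals vary, so it is enough that the code of the instance is a Diophantine function of them.
    This is why a numeral is a power of a single variable: its code involves a geometric sum. *)

Record hyp_length (G : groupType) (E : nat) (l : G -> nat) : Prop := {
  hl1 : l 1%g = 0;
  hlV : forall x, l x^-1%g = l x;
  hlM : forall x y, l (x * y)%g <= l x + l y;
  hl_geo : forall x r, r <= l x -> exists2 y, l y = r & l (y^-1 * x)%g = l x - r;
  hl_ball : forall R, exists B, forall s : seq G,
    uniq s -> (forall x, x \in s -> l x <= R) -> size s <= B;
  hl4 : forall a b c, l b + l (a^-1 * c)%g <=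
    maxn (l a + l (b^-1 * c)%g) (l c + l (a^-1 * b)%g) + E }.

(* [lia] distinguishes convertible terms [l x] whose group operations are
   elaborated along different structures, hence the generalisation. *)
Ltac llia l :=
  repeat match goal with H : context [l _] |- _ => 
    lazymatch type of H with hyp_length _ _ => fail | _ => revert H end end;
  repeat (match goal with |- context [l ?x] => 
    let n := fresh "n" in move: (l x) => n end);
  lia.

Lemma commute_conj (G : groupType) (x y z : G) :
  commute x y -> commute (x ^ z)%g (y ^ z)%g.
Proof. by rewrite /commute -!conjMg => ->. Qed.

Lemma hl_sym (G : groupType) E (l : G -> nat) (hl : hyp_length E l) x y :
  l (x^-1 * y)%g = l (y^-1 * x)%g.
Proof. by rewrite -(hlV hl (x^-1 * y)%g) invgM invgK. Qed.

(** [hl4] is the four-point condition on 1, [a], [b], [c]. Here it is applied to the parallelogram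
    1, [s], [s * t], [t], whose opposite sides have equal length because [s] and [t] commute. *)
Lemma hl_parallelogram (G : groupType) E (l : G -> nat) (hl : hyp_length E l) s t :
  commute s t -> l (s * t)%g + l (s^-1 * t)%g <= maxn (l s) (l t) + maxn (l s) (l t) + E.
Proof.
move=> c; have := hl4 hl s (s * t)%g t.
rewrite invgM -mulgA mulKg.
have -> : (t^-1 * (s^-1 * t))%g = s^-1%g.
  by rewrite (commute_sym (commuteV (commute_sym c))) mulKg.
rewrite (hlV hl); lia.
Qed.

(** Four-point condition on 1, [s], [t], [t^-1]; by commutation the distance from [s] to [t^-1] is
    [l (s * t)]. *)
Lemma hl_diagonals (G : groupType) E (l : G -> nat) (hl : hyp_length E l) s t :
  commute s t ->
  l t + l (s^-1 * t)%g <= maxn (l s + l (t ^+ 2)%g) (l t + l (s * t)%g) + E /\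
  l t + l (s * t)%g <= maxn (l s + l (t ^+ 2)%g) (l t + l (s^-1 * t)%g) + E.
Proof.
move=> c; have := hl4 hl s t^-1%g t; have := hl4 hl s t t^-1%g.
have e : l (s^-1 * t^-1)%g = l (s * t)%g by rewrite -invgM (hlV hl) c.
have e2 : l (t^-1 * t^-1)%g = l (t ^+ 2)%g by rewrite -invgM (hlV hl) expg2.
by rewrite e e2 invgK !(hlV hl) expg2; split.
Qed.

Lemma conj_minimal (G : groupType) (l : G -> nat) (T : seq G) :
  exists x, forall y, \max_(t <- T) l (t ^ x)%g <= \max_(t <- T) l (t ^ y)%g.
Proof.
have P : exists n, `[< exists x, \max_(t <- T) l (t ^ x)%g = n >].
  by exists (\max_(t <- T) l (t ^ 1)%g); apply/asboolP; exists 1%g.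
case: (ex_minnP P) => n /asboolP[x <-] min; exists x => y.
by apply: min; apply/asboolP; exists y.
Qed.

Lemma bigmax_attained (T : eqType) (s : seq T) (f : T -> nat) (D : nat) :
  0 < D -> D <= \max_(t <- s) f t -> exists2 t, t \in s & D <= f t.
Proof.
move=> D0; elim: s => [|a s IH]; first by rewrite big_nil; lia.
rewrite big_cons leq_max => /orP[h|/IH[t ts h]].
  by exists a => //; rewrite mem_head.
by exists t => //; rewrite inE ts orbT.
Qed.

(** If no element of [T] of almost maximal length were nearly additive, then
    moving the base point by [2 E + 1] along a geodesic from [1] to a longest
    element would decrease the joint displacement. *)
Lemma loxodromic_of_minimal (G : groupType) E (l : G -> nat) (hl : hyp_length E l)
    (T : seq G) (D : nat) :
  {in T &, forall s t, commute s t} ->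
  (forall t, t \in T -> l t <= D) ->
  (forall y, exists2 t, t \in T & D <= l (t ^ y)%g) ->
  20 * E + 20 <= D ->
  exists2 t, t \in T & D <= l t + (4 * E + 2) /\ 2 * l t <= l (t ^+ 2)%g + (5 * E + 2).
Proof.
move=> comm max disp bigD; apply: contrapT => no.
have {}no t : t \in T -> D <= l t + (4 * E + 2) -> l (t ^+ 2)%g + (5 * E + 2) < 2 * l t.
  by move=> tT h; rewrite ltnNge; apply/negP => h2; apply: no; exists t.
have [s sT] := disp 1%g; rewrite conjg1 => ls.
have {}ls : l s = D by have := max s sT; lia.
have [//|y ly lys] := hl_geo hl (x := s) (r := 2 * E + 1); first by lia.
have [t tT lty] := disp y.
have tD := max t tT.
have lt_ty : l (t ^ y)%g <= l t + 2 * l y.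
  have := hlM hl y^-1%g (t * y)%g; have := hlM hl t y.
  by rewrite conjgE (hlV hl); llia l.
have big_t : D <= l t + (4 * E + 2) by lia.
have lt2 := no t tT big_t.
have c := comm s t sT tT.
have par := hl_parallelogram hl c; have [d1 d2] := hl_diagonals hl c.
(* The bound [4 * E + 2] came from twice [l y = 2 * E + 1]. With the defect [5 * E + 2] of [t ^+ 2],
   [f1] and [f2] put [t] and [t^-1] at distance at most [l t - E - 1] from [y]; [f3] gives back only
   one [E], so [l (t ^ y)] falls below [D]. *)
have f1 := hl4 hl y s t; have f2 := hl4 hl y s t^-1%g; have f3 := hl4 hl y t (t * y)%g.
have e1 : l (s^-1 * t^-1)%g = l (s * t)%g by rewrite -invgM (hlV hl) c.
have e2 : l (y^-1 * t^-1)%g = l (t * y)%g by rewrite -invgM (hlV hl).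
rewrite e1 e2 (hlV hl) in f2; rewrite mulKg -conjgE in f3.
llia l.
Qed.

(** Local-to-global principle along the orbit 1, [s], [s ^+ 2], ...: each time the size of [l s]
    rules out one branch of the maximum in [hl4], and the other branch says that a step advances by
    at least [l s - (K + E)]. The defect [K + 2 * E] of the powers does not depend on [n]. *)
Lemma hl_powers (G : groupType) E (l : G -> nat) (hl : hyp_length E l) s K :
  2 * l s <= l (s ^+ 2)%g + K -> 2 * K + 4 * E + 4 <= l s ->
  forall n, n <= l (s ^+ n)%g /\ 2 * l (s ^+ n)%g <= l (s ^+ (n + n))%g + (K + 2 * E).
Proof.
move=> ax big.
have dd i j : i <= j -> l ((s ^+ i)^-1 * s ^+ j)%g = l (s ^+ (j - i))%g.
  by move=> ij; rewrite -{1}(subnKC ij) expgnDr mulKg.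
pose a n := l (s ^+ n)%g.
have a0 : a 0 = 0 by rewrite /a expg0 (hl1 hl).
have a1 : a 1 = l s by rewrite /a expg1.
have {}ax : 2 * a 1 <= a 2 + K by rewrite a1.
rewrite -a1 in big.
have rec m : a m + a 1 <= a m.+1 + (K + E).
  case: m => [|m]; first by rewrite a0; lia.
  elim: m => [|m IH]; first by lia.
  have := hl4 hl (s ^+ 1)%g (s ^+ 2)%g (s ^+ m.+3)%g.
  rewrite !dd // -/(a 2) -/(a 1) -/(a _) -/(a _) -/(a _) !subSS !subn0 -/(a _) -/(a _) -/(a _).
  lia.
have lin n : n <= a n.
  elim: n => [//|n IH]; have := rec n; lia.
move=> n; split; first exact: lin.
case: n => [|n]; first by rewrite -/(a 0) a0.
have := hl4 hl (s ^+ n)%g (s ^+ n.+1)%g (s ^+ (n.+1 + n.+1))%g.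
rewrite (dd n.+1 (n.+1 + n.+1)) ?(dd n (n.+1 + n.+1)) ?(dd n n.+1); try lia.
have -> : n.+1 + n.+1 - n = n.+2 by lia.
have -> : n.+1 + n.+1 - n.+1 = n.+1 by lia.
have -> : n.+1 - n = 1 by lia.
rewrite -/(a n) -/(a n.+1) -/(a n.+2) -/(a 1) -/(a _).
have := rec n; have := rec n.+1.
lia.
Qed.

(** By [hl_parallelogram], [w * g] and [w * h] lie almost on geodesics from 1 to [w ^+ 2]; the
    four-point condition on these four points makes them close once they are equally far from 1. *)
Lemma hl_fellow (G : groupType) E (l : G -> nat) (hl : hyp_length E l) w g h K :
  commute w g -> commute w h -> l g <= l w -> l h <= l w ->
  2 * l w <= l (w ^+ 2)%g + K -> l (w * g)%g = l (w * h)%g ->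
  l (g^-1 * h)%g <= K + 2 * E.
Proof.
move=> cg ch lg lh ax e.
have pg := hl_parallelogram hl cg; have ph := hl_parallelogram hl ch.
have := hl4 hl (w * g)%g (w ^+ 2)%g (w * h)%g.
have -> : ((w * g)^-1 * (w * h))%g = (g^-1 * h)%g by rewrite invgM -mulgA mulKg.
have -> : ((w ^+ 2)^-1 * (w * h))%g = (w^-1 * h)%g.
  by rewrite expg2 invgM -mulgA mulKg.
have -> : l ((w * g)^-1 * w ^+ 2)%g = l (w^-1 * g)%g.
  by rewrite expg2 invgM -mulgA mulKg (hl_sym hl).
llia l.
Qed.

Lemma pigeonhole (T : eqType) (s : seq T) (f : T -> nat) (W B : nat) :
  (forall x, x \in s -> f x < W) ->
  (forall v, size [seq x <- s | f x == v] <= B) -> size s <= W * B.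
Proof.
move=> + hB; elim: W s hB => [|W IH] s hB hW.
  case: s hB hW => [//|a s] _ /(_ a); rewrite mem_head => /(_ isT); by [].
rewrite -(count_predC (fun x => f x == W)) mulSn leq_add //.
  by rewrite -size_filter.
rewrite -size_filter; apply: IH => [v|x].
  by rewrite -filter_predI; apply: leq_trans (hB v); rewrite !size_filter;
     apply: sub_count => x /= /andP[].
by rewrite mem_filter /= => /andP[ne /hW]; rewrite ltnS leq_eqVlt (negbTE ne).
Qed.

Definition grid (G : groupType) (u c : G) (M : nat) : seq G :=
  [seq (u ^+ p.1 * c ^+ p.2)%g | p <- [seq (i, j) | i <- iota 0 M, j <- iota 0 M]].

Lemma size_grid (G : groupType) (u c : G) M : size (grid u c M) = M * M.
Proof. by rewrite size_map size_allpairs size_iota. Qed.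

Lemma gridP (G : groupType) (u c : G) M g :
  g \in grid u c M -> exists i j, [/\ i < M, j < M & g = (u ^+ i * c ^+ j)%g].
Proof.
move=> /mapP[p /allpairsP[q [h1 h2 ->]] ->].
by exists q.1, q.2; move: h1 h2; rewrite !mem_iota.
Qed.

Lemma uniq_grid (G : groupType) (u c : G) M :
  injective (fun p => u ^+ p.1 * c ^+ p.2)%g -> uniq (grid u c M).
Proof.
move=> inj; rewrite map_inj_uniq //; apply: allpairs_uniq; rewrite ?iota_uniq //.
by move=> [? ?] [? ?].
Qed.

Lemma commute_grid (G : groupType) (u c : G) M :
  commute u c -> {in grid u c M &, forall g h, commute g h}.
Proof.
move=> uc g h /gridP[i [j [_ _ ->]]] /gridP[i' [j' [_ _ ->]]].
by apply: commuteM; apply: commute_sym; apply: commuteM; apply: commuteX2.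
Qed.

Lemma hlX (G : groupType) E (l : G -> nat) (hl : hyp_length E l) x n :
  l (x ^+ n)%g <= n * l x.
Proof.
elim: n => [|n IH]; first by rewrite expg0 (hl1 hl).
by rewrite expgS; have := hlM hl x (x ^+ n)%g; rewrite mulSn; llia l.
Qed.

(** Seen from far out on the axis, the [M ^ 2] elements [u ^+ i * c ^+ j] take
    [O(M)] positions, and those at the same position differ by an element of a
    fixed ball. *)
Lemma axis_bounds_rank (G : groupType) E (l : G -> nat) (hl : hyp_length E l) (u c : G) K :
  commute u c -> injective (fun p => u ^+ p.1 * c ^+ p.2)%g ->
  ~ (forall L0, exists w, [/\ commute w u, commute w c, L0 <= l w &
                              2 * l w <= l (w ^+ 2)%g + K]).
Proof.
move=> uc inj axis.
have [B hB] := hl_ball hl (K + 2 * E).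
(* [M] is chosen so that [M * M] exceeds [(2 * (M * C) + 1) * B], the number of positions times the
   number of grid elements possible at each. *)
pose C := l u + l c; pose M := ((2 * C + 1) * B).+1.
have [w [wu wc lw ax]] := axis (M * C).
have cg g : g \in grid u c M -> commute w g.
  by move=> /gridP[i [j [_ _ ->]]]; apply: commuteM; apply: commuteX.
have lg g : g \in grid u c M -> l g <= M * C.
  move=> /gridP[i [j [iM jM ->]]].
  have h1 := hlX hl u i; have h2 := hlX hl c j; have h3 := hlM hl (u ^+ i)%g (c ^+ j)%g.
  have : i * l u <= M * l u by rewrite leq_mul2r (ltnW iM) orbT.
  have : j * l c <= M * l c by rewrite leq_mul2r (ltnW jM) orbT.
  rewrite /C mulnDr; llia l.
have : size (grid u c M) <= (2 * (M * C)).+1 * B.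
  (* Multiplication by a grid element changes [l w] by at most [M * C]; the shift by [l w - M * C]
     moves the positions into an initial segment of the natural numbers. *)
  apply: (@pigeonhole _ _ (fun g => l (w * g)%g - (l w - M * C))).
    move=> g gS; have := hlM hl w g; have := lg g gS; llia l.
  move=> v; case E1: [seq _ <- _ | _] => [//|g0 S']; rewrite -E1.
  have g0S : g0 \in [seq x <- grid u c M | l (w * x)%g - (l w - M * C) == v].
    by rewrite E1 mem_head.
  move: g0S; rewrite mem_filter => /andP[/eqP e0 g0S].
  rewrite -(size_map (fun g => g0^-1 * g)%g); apply: hB.
    by rewrite map_inj_uniq ?filter_uniq ?uniq_grid //; apply: mulgI.
  move=> _ /mapP[g + ->]; rewrite mem_filter => /andP[/eqP e1 gS].
  have low x : x \in grid u c M -> l w - M * C <= l (w * x)%g.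
    move=> xS; have := hlM hl (w * x)%g x^-1%g; rewrite mulgK (hlV hl).
    have := lg x xS; llia l.
  apply: (hl_fellow hl (cg _ g0S) (cg _ gS)) => //.
  - exact: leq_trans (lg _ g0S) lw.
  - exact: leq_trans (lg _ gS) lw.
  - by have := low _ g0S; have := low _ gS; llia l.
rewrite size_grid {1 2}/M; nia.
Qed.

(** More than [B] distinct elements cannot all be conjugated into the ball of radius [D0], so the
    grid has large minimal joint displacement. The powers of the nearly additive element found there
    commute with the conjugated grid and become arbitrarily long, as [axis_bounds_rank] forbids. *)
Theorem hyp_length_no_Z2 (G : groupType) E (l : G -> nat) (hl : hyp_length E l) (u c : G) :
  commute u c -> ~ injective (fun p => u ^+ p.1 * c ^+ p.2)%g.
Proof.
move=> uc inj.
(* [K] is the defect delivered by [loxodromic_of_minimal]. [D0] covers the size required there and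
   the one required by [hl_powers], after the loss of [4 * E + 2]. *)
pose K := 5 * E + 2; pose D0 := 20 * E + 20 + (2 * K + 4 * E + 4 + (4 * E + 2)).
have [B hB] := hl_ball hl D0.
pose T := grid u c B.+1.
have [x minx] := conj_minimal l T.
set D := \max_(t <- T) l (t ^ x)%g in minx.
have DD0 : D0 <= D.
  rewrite leqNgt; apply/negP => lt.
  have : size [seq (t ^ x)%g | t <- T] <= B.
    apply: hB; first by rewrite map_inj_uniq ?uniq_grid //; apply: conjg_inj.
    move=> _ /mapP[t tT ->]; apply: leq_trans (ltnW lt).
    exact: (@leq_bigmax_seq _ T xpredT (fun t => l (t ^ x)%g)).
  by rewrite size_map size_grid; nia.
have D0' : 0 < D by rewrite (leq_trans _ DD0) // /D0; lia.
have [||||t'] := @loxodromic_of_minimal G E l hl [seq (t ^ x)%g | t <- T] D.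
- move=> _ _ /mapP[s sT ->] /mapP[t tT ->]; apply: commute_conj.
  exact: commute_grid uc _ _ sT tT.
- move=> _ /mapP[t tT ->]; exact: (@leq_bigmax_seq _ T xpredT (fun t => l (t ^ x)%g)).
- move=> y; have [//|t tT ht] := bigmax_attained _ (minx (x * y)%g).
  by exists (t ^ x)%g; [exact: (map_f (fun t => t ^ x)%g)|rewrite -conjgM].
- by rewrite (leq_trans _ DD0) // /D0; lia.
move=> /mapP[t tT ->] [big ax].
have pw := hl_powers hl ax.
have {}pw := pw _; apply: (@axis_bounds_rank _ _ _ hl (u ^ x)%g (c ^ x)%g (K + 2 * E)).
- exact: commute_conj.
- move=> p q /=; rewrite -!conjXg -!conjMg => /conjg_inj; exact: inj.
move=> L0; exists ((t ^ x) ^+ L0)%g.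
have [|h1 h2] := pw _ L0; first by move: DD0; rewrite /D0 -/K; llia l.
have ct z : z = u \/ z = c -> commute ((t ^ x) ^+ L0)%g (z ^ x)%g.
  move=> hz; apply: commute_sym; apply: commuteX; apply: commute_conj.
  have [i [j [_ _ ->]]] := gridP tT.
  by apply: commuteM; apply: commuteX; case: hz => ->.
split=> //; [by apply: ct; left|by apply: ct; right|].
by rewrite -expgnA muln2 -addnn.
Qed.

(** * Word length in a hyperbolic group *)

Lemma eval_word_cat (A : Type) (H : groupType) (v : A -> H) (w1 w2 : word A) :
  eval_word v (w1 ++ w2) = (eval_word v w1 * eval_word v w2)%g.
Proof. by rewrite /eval_word big_cat. Qed.

Definition inv_word (A : Type) (w : word A) : word A :=
  rev [seq (p.1, ~~ p.2) | p <- w].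

Lemma eval_inv_word (A : Type) (H : groupType) (v : A -> H) (w : word A) :
  eval_word v (inv_word w) = (eval_word v w)^-1%g.
Proof.
elim: w => [|[a b] w IH]; first by rewrite /eval_word /= !big_nil invg1.
rewrite /inv_word /= rev_cons -cats1 eval_word_cat IH /eval_word big_seq1 big_cons /=.
by rewrite invgM; case: b; rewrite ?invgK.
Qed.

Lemma word_length_le (G : groupType) n (s : n.-tuple G) (gen : generates s) w :
  word_length gen (eval_word (tnth s) w) <= size w.
Proof.
rewrite /word_length; case: ex_minnP => l _; apply.
by apply/existsP; exists (in_tuple w).
Qed.

Lemma word_length_attained (G : groupType) n (s : n.-tuple G) (gen : generates s) g :
  exists2 w, size w = word_length gen g & eval_word (tnth s) w = g.
Proof.
rewrite /word_length; case: ex_minnP => l /existsP[w /eqP e] _.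
by exists w; rewrite ?size_tuple.
Qed.

Lemma word_length_geodesic (G : groupType) n (s : n.-tuple G) (gen : generates s) x r :
  r <= word_length gen x -> exists2 y, word_length gen y = r &
    word_length gen (y^-1 * x)%g = word_length gen x - r.
Proof.
have [w sw e] := word_length_attained gen x; rewrite -sw => rw.
pose y := eval_word (tnth s) (take r w); pose z := eval_word (tnth s) (drop r w).
have exy : x = (y * z)%g by rewrite -e -[in LHS](cat_take_drop r w) eval_word_cat.
have ly : word_length gen y <= r.
  by apply: leq_trans (word_length_le gen _) _; rewrite size_takel.
have lz : word_length gen z <= size w - r.
  by apply: leq_trans (word_length_le gen _) _; rewrite size_drop.
have [wy sy ey] := word_length_attained gen y.
have [wz sz ez] := word_length_attained gen z.
have := word_length_le gen (wy ++ wz).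
rewrite eval_word_cat ey ez -exy size_cat sy sz -sw => h.
by exists y; [lia|rewrite exy mulKg; lia].
Qed.

Lemma word_length_ball (G : groupType) n (s : n.-tuple G) (gen : generates s) R :
  exists B, forall t : seq G, uniq t -> (forall x, x \in t -> word_length gen x <= R) ->
    size t <= B.
Proof.
pose ball := flatten [seq [seq eval_word (tnth s) (tval w) |
  w <- enum {: k.-tuple ('I_n * bool)}] | k <- iota 0 R.+1].
exists (size ball) => t ut ht; apply: uniq_leq_size => // x /ht.
have [w <- <-] := word_length_attained gen x => sw.
apply/flattenP; exists [seq eval_word (tnth s) (tval w0) |
  w0 <- enum {: (size w).-tuple ('I_n * bool)}].
  by apply/mapP; exists (size w) => //; rewrite mem_iota add0n ltnS.
by apply/mapP; exists (in_tuple w); rewrite ?mem_enum.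
Qed.

(** [E] is an integer above [2 * delta]: doubling the inequality between Gromov products at base
    point 1 and cancelling common lengths leaves the four-point condition. *)
Lemma hyperbolic_hyp_length (G : groupType) :
  hyperbolic G -> exists E (l : G -> nat), hyp_length E l.
Proof.
move=> [n [s [gen [delta [d0 hyp]]]]].
have [E hE] : exists E : nat, (2%:R * delta <= E%:R)%R.
  exists (Num.bound (2%:R * delta)%R).
  by apply/Order.POrderTheory.ltW/Num.Theory.archi_boundP; lra.
have lV x : word_length gen x^-1%g = word_length gen x.
  suff h y : word_length gen y^-1%g <= word_length gen y.
    by apply/eqP; rewrite eqn_leq h -[X in word_length gen X <= _]invgK h.
  have [w <- <-] := word_length_attained gen y.
  rewrite -eval_inv_word; apply: leq_trans (word_length_le gen _) _.
  by rewrite /inv_word size_rev size_map.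
exists E, (word_length gen); split=> //.
- apply/eqP; rewrite -leqn0; have := word_length_le gen [::].
  by rewrite /eval_word big_nil.
- move=> x y; have [wx <- ex] := word_length_attained gen x.
  have [wy <- ey] := word_length_attained gen y.
  by rewrite -ex -ey -eval_word_cat -size_cat word_length_le.
- exact: word_length_geodesic.
- exact: word_length_ball.
- move=> a b c; have := hyp 1%g a b c; rewrite /gromov_product /word_dist !mulg1 !lV.
  move: (word_length gen a) (word_length gen b) (word_length gen c) => la lb lc.
  move: (word_length _ _) (word_length _ _) (word_length _ _) => ac bc ab.
  rewrite /Num.min; case: ifP => _ h.
    suff : lb + ac <= lc + ab + E by lia.
    by rewrite -(Num.Theory.ler_nat rat) !GRing.natrD; lra.
  suff : lb + ac <= la + bc + E by lia.
  by rewrite -(Num.Theory.ler_nat rat) !GRing.natrD; lra.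
Qed.

Lemma hyperbolic_no_Z2 (G : groupType) (u c : G) : hyperbolic G -> commute u c ->
  exists i j i' j', [/\ (i, j) != (i', j') & (u ^+ i * c ^+ j = u ^+ i' * c ^+ j')%g].
Proof.
move=> /hyperbolic_hyp_length[E [l hl]] uc; apply: contrapT => no.
apply: (hyp_length_no_Z2 hl uc) => -[i j] [i' j'] /= e; apply/eqP/negPn/negP => ne.
by apply: no; exists i, j, i', j'.
Qed.

(** * Solutions of the Pell equation *)

Section Pell.

Local Open Scope ring_scope.

(** The coefficients of the [n]-th power of the unit [a + sqrt (a * a - 1)]. *)
Fixpoint pell (a : int) (n : nat) : int * int :=
  if n is m.+1 then
    let: (x, y) := pell a m in (a * x + (a * a - 1) * y, x + a * y)
  else (1, 0).

Definition px a n := (pell a n).1.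
Definition py a n := (pell a n).2.

Lemma px0 (a : int) : px a 0 = 1. Proof. by []. Qed.
Lemma py0 (a : int) : py a 0 = 0. Proof. by []. Qed.

Lemma pxS (a : int) n : px a n.+1 = a * px a n + (a * a - 1) * py a n.
Proof. by rewrite /px /py /=; case: (pell a n). Qed.

Lemma pyS (a : int) n : py a n.+1 = px a n + a * py a n.
Proof. by rewrite /px /py /=; case: (pell a n). Qed.


Lemma pell_eq (a : int) n : px a n * px a n = (a * a - 1) * py a n * py a n + 1.
Proof.
elim: n => [|n IH]; first by rewrite px0 py0; ring.
rewrite pxS pyS; move: IH; set x := px a n; set y := py a n => IH.
have -> : (a * x + (a * a - 1) * y) * (a * x + (a * a - 1) * y) =
  a * a * (x * x) + (a * a - 1) * (a * a - 1) * y * y + 2 * a * (a * a - 1) * x * y by ring.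
have -> : (a * a - 1) * (x + a * y) * (x + a * y) =
  (a * a - 1) * (x * x) + (a * a - 1) * a * a * y * y + 2 * a * (a * a - 1) * x * y by ring.
rewrite IH; ring.
Qed.

Lemma pxD (a : int) m n : px a (m + n) = px a m * px a n + (a * a - 1) * py a m * py a n
with pyD a m n : py a (m + n) = px a m * py a n + py a m * px a n.
Proof.
  elim: m => [|m IH]; first by rewrite px0 py0 add0n; ring.
  by rewrite addSn !pxS IH pyD pyS; ring.
elim: m => [|m IH]; first by rewrite px0 py0 add0n; ring.
by rewrite addSn !pyS IH pxD pxS; ring.
Qed.

Lemma pxB (a : int) m n : (n <= m)%N ->
  px a (m - n) = px a m * px a n - (a * a - 1) * py a m * py a n.
Proof.
move=> nm; rewrite -{2 3}(subnK nm) pxD pyD; move: (m - n)%N => k.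
have := pell_eq a n; set x := px a n; set y := py a n => e.
have -> : (px a k * x + (a * a - 1) * py a k * y) * x -
  (a * a - 1) * (px a k * y + py a k * x) * y =
  px a k * (x * x - (a * a - 1) * y * y) by ring.
by rewrite e; ring.
Qed.

Lemma pell_step_le (a x y : int) : 1 < a -> 0 <= x -> 0 <= y ->
  2 * x <= a * x /\ 2 * y <= a * y /\ y <= (a * a - 1) * y.
Proof.
move=> a1 x0 y0; split; first by apply: ler_wpM2r => //; lia.
split; first by apply: ler_wpM2r => //; lia.
by rewrite -[leLHS]mul1r; apply: ler_wpM2r => //; nia.
Qed.

Lemma px_gt0_py_ge0 (a : int) n : 1 < a -> 0 < px a n /\ 0 <= py a n.
Proof.
move=> a1; elim: n => [//|n [x0 y0]]; rewrite pxS pyS.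
have := pell_step_le a1 (ltW x0) y0; lia.
Qed.

Lemma px_gt0 (a : int) n : 1 < a -> 0 < px a n.
Proof. by case/(px_gt0_py_ge0 n). Qed.

Lemma py_ge0 (a : int) n : 1 < a -> 0 <= py a n.
Proof. by case/(px_gt0_py_ge0 n). Qed.

Lemma py_lt (a : int) m n : 1 < a -> (m < n)%N -> py a m < py a n.
Proof.
move=> a1; elim: n => [//|n IH]; rewrite ltnS leq_eqVlt => /orP[/eqP->|/IH h].
  rewrite pyS; have := pell_step_le a1 (ltW (px_gt0 n a1)) (py_ge0 n a1).
  by have := px_gt0 n a1; have := py_ge0 n a1; lia.
rewrite pyS; have := pell_step_le a1 (ltW (px_gt0 n a1)) (py_ge0 n a1).
by have := px_gt0 n a1; have := py_ge0 n a1; lia.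
Qed.

Lemma px_lt (a : int) m n : 1 < a -> (m < n)%N -> px a m < px a n.
Proof.
move=> a1; elim: n => [//|n IH]; rewrite ltnS leq_eqVlt => /orP[/eqP->|/IH h].
  rewrite pxS; have := pell_step_le a1 (ltW (px_gt0 n a1)) (py_ge0 n a1).
  by have := px_gt0 n a1; have := py_ge0 n a1; lia.
rewrite pxS; have := pell_step_le a1 (ltW (px_gt0 n a1)) (py_ge0 n a1).
by have := px_gt0 n a1; have := py_ge0 n a1; lia.
Qed.

Lemma py_ge (a : int) n : 1 < a -> n%:Z <= py a n.
Proof. by move=> a1; elim: n => [//|n IH]; have := py_lt a1 (ltnSn n); lia. Qed.

Lemma px_inj (a : int) : 1 < a -> injective (px a).
Proof.
move=> a1 m n e; case: (ltngtP m n) => // h; have := px_lt a1 h; rewrite e; lia.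
Qed.

Lemma px_expge (a : int) n : 1 < a -> a ^+ n <= px a n.
Proof.
move=> a1; elim: n => [//|n IH]; rewrite exprS pxS.
have := pell_step_le a1 (ltW (px_gt0 n a1)) (py_ge0 n a1); have := py_ge0 n a1.
have : a * a ^+ n <= a * px a n by apply: ler_wpM2l => //; lia.
lia.
Qed.

(** Descent: division by the fundamental unit replaces [y] by [a * y - x], which is non-negative and
    below [y] because [(a - 1) * y < x <= a * y]. *)
Lemma pell_complete (a : int) (x y : int) : 1 < a -> 0 <= x -> 0 <= y ->
  x * x = (a * a - 1) * y * y + 1 -> exists n, x = px a n /\ y = py a n.
Proof.
move=> a1 + y0; move: x; have [k] : exists k : nat, y <= k%:Z by exists `|y|%N; lia.
elim: k y y0 => [|k IH] y y0 yk x x0 e.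
  have ey : y = 0 by lia.
  by exists 0%N; rewrite px0 py0; split=> //; rewrite ey in e; nia.
have [ey|yn] := eqVneq y 0.
  by exists 0%N; rewrite px0 py0; split=> //; rewrite ey in e; nia.
have y1 : 0 < y by lia.
have h1 : x <= a * y by nia.
have h2 : (a - 1) * y < x by nia.
have h3 : 0 <= a * x - (a * a - 1) * y by nia.
have [||||n [ex ey]] := IH (a * y - x) _ _ (a * x - (a * a - 1) * y).
- lia.
- lia.
- exact: h3.
- have -> : (a * x - (a * a - 1) * y) * (a * x - (a * a - 1) * y) =
    a * a * (x * x) + (a * a - 1) * (a * a - 1) * y * y - 2 * a * (a * a - 1) * x * y by ring.
  have -> : (a * a - 1) * (a * y - x) * (a * y - x) =
    (a * a - 1) * (x * x) + (a * a - 1) * a * a * y * y - 2 * a * (a * a - 1) * x * y by ring.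
  by rewrite e; ring.
by exists n.+1; rewrite pxS pyS -ex -ey; split; ring.
Qed.

(** * Divisibility and congruences between Pell solutions *)

Lemma dvdz_congr (d x y : int) : (d %| x - y)%Z -> (d %| x)%Z = (d %| y)%Z.
Proof. by move=> h; rewrite -{1}(subrK y x) rpredDl. Qed.

Lemma coprime_px_py (a : int) n : coprimez (px a n) (py a n).
Proof.
apply/coprimezP; exists (px a n, - ((a * a - 1) * py a n)) => /=.
by have := pell_eq a n => ->; ring.
Qed.

Lemma px_congr (a b c : int) n : (c %| a - b)%Z ->
  (c %| px a n - px b n)%Z /\ (c %| py a n - py b n)%Z.
Proof.
move=> /dvdzP[q /eqP]; rewrite subr_eq => /eqP->.
elim: n => [|n [/dvdzP[q1 /eqP]]]; first by rewrite !px0 !py0 !subrr dvdz0.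
rewrite subr_eq => /eqP e1 /dvdzP[q2 /eqP]; rewrite subr_eq => /eqP e2.
rewrite !pxS !pyS e1 e2; move: (px b n) (py b n) => x y.
split; apply/dvdzP.
  exists (q * (q1 * c + x) + b * q1 + (q * c + 2 * b) * q * (q2 * c + y) +
    (b * b - 1) * q2); ring.
exists (q1 + q * (q2 * c + y) + b * q2); ring.
Qed.

Lemma px_1 n : px 1 n = 1 /\ py 1 n = n%:Z.
Proof.
by elim: n => [|n [e1 e2]] //; rewrite pxS pyS e1 e2; split; [ring|lia].
Qed.

(** In the degenerate base 1 the second coordinate is the index itself, and solutions for congruent
    bases are congruent. *)
Lemma py_congr_index (a : int) n : (a - 1 %| py a n - n%:Z)%Z.
Proof.
have [_ e] := px_1 n; rewrite -[n%:Z]e.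
by have [] := px_congr n (dvdzz (a - 1)).
Qed.

Lemma py_dvd_mul (a : int) n k : (py a n %| py a (n * k))%Z.
Proof.
elim: k => [|k IH]; first by rewrite muln0 py0 dvdz0.
by rewrite mulnS pyD; apply: rpredD; [apply: dvdz_mull|apply: dvdz_mulr].
Qed.

(** Division of [n] by [m] with remainder: [py a m] is coprime to the first coordinate at the
    multiple of [m], so it divides the second coordinate at the remainder, which is smaller and
    hence 0. *)
Lemma py_dvd (a : int) m n : 1 < a -> (py a m %| py a n)%Z -> (m %| n)%N.
Proof.
move=> a1; case: m => [|m].
  rewrite py0 dvd0z => /eqP e; case: n e => [//|n] e.
  by have := py_ge n.+1 a1; rewrite e; lia.
rewrite {1}(divn_eq n m.+1) pyD mulnC => h.
have h1 : (py a m.+1 %| px a (m.+1 * (n %/ m.+1)) * py a (n %% m.+1))%Z.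
  by move: h; rewrite rpredDr // dvdz_mulr // py_dvd_mul.
have cop : coprimez (py a m.+1) (px a (m.+1 * (n %/ m.+1))).
  have [q e] := dvdzP (py_dvd_mul a m.+1 (n %/ m.+1)).
  have := coprime_px_py a (m.+1 * (n %/ m.+1)); rewrite e coprimezMr => /andP[_].
  by rewrite coprimez_sym.
rewrite Gauss_dvdzr // in h1.
have lt := ltn_mod n m.+1; rewrite ltn0Sn in lt.
have lt2 := py_lt a1 lt; have ge := py_ge0 (n %% m.+1) a1.
have ge2 := py_ge (n %% m.+1) a1.
have e0 : py a (n %% m.+1) = 0.
  apply/eqP; apply: contraTT h1 => ne; apply/negP => /dvdzP[q' e].
  move: ne lt2 ge; rewrite e => {e}; have : 0 < py a m.+1 by have := py_ge m.+1 a1; lia.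
  by move: (py a m.+1) => y; case: (lerP q' 0) => hq; nia.
by rewrite /dvdn; apply/eqP; lia.
Qed.

(** Binomial expansion of the [k]-th power of [px a n + py a n * sqrt (a * a - 1)] modulo the square
    of [py a n]. The extra factor [px a n] in the second congruence avoids the exponent [k - 1]. *)
Lemma pell_mul_congr (a : int) n k :
  (py a n * py a n %| px a (n * k) - px a n ^+ k)%Z /\
  (py a n * py a n %| py a (n * k) * px a n - k%:Z * px a n ^+ k * py a n)%Z.
Proof.
elim: k => [|k [/dvdzP[q1 e1] /dvdzP[q2 e2]]].
  by rewrite muln0 px0 py0 expr0 !mul0r !subrr !dvdz0.
have [q3 e3] := dvdzP (py_dvd_mul a n k).
rewrite mulnSr pxD pyD exprS; move/eqP: e1; rewrite subr_eq => /eqP e1.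
move/eqP: e2; rewrite subr_eq => /eqP e2.
split; apply/dvdzP.
  exists (q1 * px a n + (a * a - 1) * q3); rewrite e1 e3; ring.
exists (q1 * px a n * py a n + q2 * px a n); rewrite mulrDl.
rewrite e2 e1 -addn1 PoszD; ring.
Qed.

Lemma py_sqr_dvd (a : int) n k : 1 < a -> (0 < n)%N ->
  (py a n * py a n %| py a (n * k))%Z = (py a n %| k%:Z)%Z.
Proof.
move=> a1 n0; have [_ h] := pell_mul_congr a n k.
have cop := coprime_px_py a n; rewrite coprimez_sym in cop.
have cop2 : coprimez (py a n * py a n) (px a n) by rewrite coprimezMl cop.
have nz : py a n != 0 by have := py_ge n a1; lia.
rewrite -(Gauss_dvdzl _ cop2) (dvdz_congr h) dvdz_mul2r // mulrC.
by rewrite Gauss_dvdzr // coprimezXr.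
Qed.

(** Modulo [px a n] the unit with index [2 * n] has coordinates -1 and 0, so a shift or reflection
    by [2 * n] changes the sign of the first coordinate. *)
Lemma px_2n (a : int) n i :
  (px a n %| px a (2 * n + i) + px a i)%Z /\
  ((i <= 2 * n)%N -> (px a n %| px a (2 * n - i) + px a i)%Z).
Proof.
have [e1 e2] : px a (2 * n) = 2 * (px a n * px a n) - 1 /\ py a (2 * n) = 2 * px a n * py a n.
  rewrite mul2n -addnn pxD pyD; split; last by ring.
  by rewrite pell_eq; ring.
split=> [|le].
  apply/dvdzP; exists (2 * px a n * px a i + (a * a - 1) * (2 * py a n) * py a i).
  by rewrite pxD e1 e2; ring.
apply/dvdzP; exists (2 * px a n * px a i - (a * a - 1) * (2 * py a n) * py a i).
by rewrite pxB // e1 e2; ring.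
Qed.

Lemma px_4n (a : int) n i q : (px a n %| px a (q * (4 * n) + i) - px a i)%Z.
Proof.
elim: q => [|q IH]; first by rewrite mul0n add0n subrr dvdz0.
have -> : (q.+1 * (4 * n) + i = 2 * n + (2 * n + (q * (4 * n) + i)))%N by rewrite mulSn; lia.
set j := (q * _ + i)%N in IH *.
have [h1 _] := px_2n a n (2 * n + j); have [h2 _] := px_2n a n j.
have -> : px a (2 * n + (2 * n + j)) - px a i = (px a (2 * n + (2 * n + j)) + px a (2 * n + j))
  - (px a (2 * n + j) + px a j) + (px a j - px a i) by ring.
by rewrite rpredD // rpredB.
Qed.

Lemma px_le (a : int) m n : 1 < a -> (m <= n)%N -> px a m <= px a n.
Proof.
by move=> a1; rewrite leq_eqVlt => /orP[/eqP->|/(px_lt a1)/ltW].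
Qed.

Lemma dvdz_small (d x : int) : (d %| x)%Z -> `|x| < d -> x = 0.
Proof. by move=> /dvdzP[q ->]; case: (ltgtP q 0) => hq h; [nia|nia|rewrite hq mul0r]. Qed.

Lemma px_mod_inj (a : int) n i r : 1 < a -> (i <= n)%N -> (r <= n)%N ->
  (px a n %| px a i - px a r)%Z -> i = r.
Proof.
move=> a1 li lr h; apply: (px_inj a1); apply/eqP; rewrite -subr_eq0; apply/eqP.
apply: dvdz_small h _; have := px_le a1 li; have := px_le a1 lr.
have := px_gt0 i a1; have := px_gt0 r a1; lia.
Qed.

(** Below [n] two first coordinates add up to less than [px a n], since the sequence more than
    doubles at its last step. The condition [0 < i] excludes [a = 2], [n = 1], [i = r = 0], where 1
    + 1 = 2. *)
Lemma px_mod_anti (a : int) n i r : 1 < a -> (0 < i <= n)%N -> (r <= n)%N ->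
  (px a n %| px a i + px a r)%Z -> i = n /\ r = n.
Proof.
move=> a1 /andP[i0 li] lr h.
have pi := px_gt0 i a1; have pr := px_gt0 r a1.
have {}h : (px a n %| px a i + px a r - px a n)%Z by rewrite rpredB.
have [/eqP ein|ne_in] := eqVneq i n.
  split; first exact/eqP.
  have /(px_mod_inj a1) : (px a n %| px a r - px a n)%Z.
    have -> : px a r - px a n = px a i + px a r - px a n - px a n by rewrite (eqP ein); ring.
    by rewrite rpredB.
  by apply.
have [n1 en] : exists n1, n = n1.+1 by case: n li lr {h ne_in} => [|n1 *]; [lia|exists n1].
have li1 : px a i <= px a n1 by apply: px_le => //; lia.
have := pxS a n1; rewrite -en => e.
have [e2 [_ e3]] := pell_step_le a1 (ltW (px_gt0 n1 a1)) (py_ge0 n1 a1).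
have n10 : (0 < n1)%N by lia.
have y1 : 0 < py a n1 by have := py_ge n1 a1; lia.
have [/eqP ern|ne_rn] := eqVneq r n.
  have : px a i = 0; last by lia.
  apply: dvdz_small (_ : (px a n %| _)%Z) _; last by lia.
  by move: h; rewrite (eqP ern) addrK.
have lr1 : px a r <= px a n1 by apply: px_le => //; lia.
have : px a i + px a r - px a n = 0 by apply: dvdz_small h _; lia.
lia.
Qed.

Lemma px_congr_index (a : int) n i j : 1 < a -> (0 < i <= n)%N ->
  (px a n %| px a i - px a j)%Z ->
  (4 * n%:Z %| j%:Z - i%:Z)%Z \/ (4 * n%:Z %| j%:Z + i%:Z)%Z.
Proof.
move=> a1 hi h; have /andP[i0 li] := hi.
have n0 : (0 < n)%N by lia.
have ej := divn_eq j (4 * n); set q := (j %/ _)%N in ej; set r := (j %% _)%N in ej.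
have lr : (r < 4 * n)%N by rewrite ltn_mod; lia.
have {h} h : (px a n %| px a i - px a r)%Z.
  have -> : px a i - px a r = (px a i - px a j) + (px a j - px a r) by ring.
  by rewrite rpredD // ej px_4n.
have ejz : j%:Z = q%:Z * (4 * n%:Z) + r%:Z by lia.
suff : (4 * n%:Z %| r%:Z - i%:Z)%Z \/ (4 * n%:Z %| r%:Z + i%:Z)%Z.
  by rewrite ejz -!addrA; case=> h2; [left|right]; rewrite rpredD // dvdz_mull.
(* One case for each quarter of the period [4 * n]: [px_2n] folds [r] back to [r], [2 * n - r],
   [r - 2 * n] or [4 * n - r], with a change of sign in the two middle quarters. *)
have [r1|r1] := leqP r n.
  by left; rewrite (px_mod_inj a1 li r1 h) subrr dvdz0.
have anti r' : (r' <= n)%N -> (px a n %| px a r + px a r')%Z -> i = n /\ r' = n.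
  move=> l' h'; apply: (px_mod_anti a1) => //.
  have -> : px a i + px a r' = (px a i - px a r) + (px a r + px a r') by ring.
  by rewrite rpredD.
have [r2|r2] := leqP r (2 * n).
  have [||e1 e2] := anti (2 * n - r)%N; first by lia.
    have [_ hh] := px_2n a n (2 * n - r).
    by have := hh (leq_subr _ _); rewrite subKn.
  by left; have -> : r%:Z - i%:Z = 0 by lia.
have [r3|r3] := leqP r (3 * n).
  have [||e1 e2] := anti (r - 2 * n)%N; first by lia.
    have [hh _] := px_2n a n (r - 2 * n).
    by rewrite subnKC in hh; [|lia].
  by right; have -> : r%:Z + i%:Z = 4 * n%:Z by lia.
right; have [w ew] : exists w, (r + w = 4 * n)%N.
  by exists (4 * n - r)%N; rewrite subnKC // ltnW.
have wn : (w <= n)%N by clear -ew r3; lia.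
have wn2 : (w <= 2 * n)%N by clear -wn; lia.
have er : (r = 2 * n + (2 * n - w))%N by rewrite addnBA //; clear -ew; lia.
have [h1 _] := px_2n a n (2 * n - w); rewrite -er in h1.
have [_ /(_ wn2) h2] := px_2n a n w.
have : i = w.
  apply: (px_mod_inj a1 li wn).
  have -> : px a i - px a w = (px a i - px a r) +
    (px a r + px a (2 * n - w)) - (px a (2 * n - w) + px a w) by ring.
  by rewrite rpredB // rpredD.
by move=> ->; rewrite -PoszD ew PoszM dvdzz.
Qed.

(** Modulo [2 * a * b - b * b - 1] the difference [b - a] is a square root of [a * a - 1], so the
    unit [a + sqrt (a * a - 1)] becomes [b]. *)
Lemma px_exp_congr (a b : int) k :
  (2 * a * b - b * b - 1 %| px a k - (a - b) * py a k - b ^+ k)%Z.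
Proof.
elim: k => [|k /dvdzP[q e]].
  by rewrite px0 py0 expr0; have -> : 1 - (a - b) * 0 - 1 = 0 :> int by ring; rewrite dvdz0.
rewrite pxS pyS exprS; apply/dvdzP; exists (py a k + b * q).
have -> : b ^+ k = px a k - (a - b) * py a k - q * (2 * a * b - b * b - 1) by rewrite -e; ring.
ring.
Qed.

Lemma eqmodz (m n d : nat) : (m = n %[mod d])%N <-> (d%:Z %| m%:Z - n%:Z)%Z.
Proof.
rewrite -eqz_mod_dvd !modz_nat; split=> [->//|/eqP[] //].
Qed.

(** Matiyasevich's system: the solution [(s, t)] for the base [b] carries the
    index [k] of [(x, y)], through [b = 1 %[mod 4 * y]] and [b = a %[mod u]]. *)
Lemma pell_char_sound (a k x y u v s t b : nat) : (1 < a)%N -> (0 < k <= y)%N ->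
  (x * x + y * y = a * a * y * y + 1)%N -> (u * u + v * v = a * a * v * v + 1)%N ->
  (s * s + t * t = b * b * t * t + 1)%N -> (1 < b)%N -> (b = 1 %[mod 4 * y])%N ->
  (b = a %[mod u])%N -> (0 < v)%N -> (y * y %| v)%N -> (s = x %[mod u])%N ->
  (t = k %[mod 4 * y])%N -> x%:Z = px a k /\ y%:Z = py a k.
Proof.
have toZ p q c : (p * p + q * q = c * c * q * q + 1)%N ->
    p%:Z * p%:Z = (c%:Z * c%:Z - 1) * q%:Z * q%:Z + 1 by lia.
move=> a1 /andP[k0 ky] /toZ e1 /toZ e2 /toZ e3 b1.
have a1' : (1 < a%:Z) by clear -a1; lia.
have b1' : (1 < b%:Z) by clear -b1; lia.
move=> m1 m2 v0 yv m3 m4.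
have [i [ex ey]] := pell_complete (x := x%:Z) (y := y%:Z) a1' isT isT e1.
have [n [eu ev]] := pell_complete (x := u%:Z) (y := v%:Z) a1' isT isT e2.
have [j [es et]] := pell_complete (x := s%:Z) (y := t%:Z) b1' isT isT e3.
(* From [y * y %| v] follows [y %| n], so [px_congr_index] gives [j = i] or [j = - i] modulo
   [4 * y]. Since [4 * y] divides [b - 1], [t] is congruent both to [j] and to [k]; the bounds
   [0 < k <= y] and [0 < i <= y] then leave only [k = i]. *)
suff -> : k = i by [].
have i0 : (0 < i)%N by case: i {ex} ey => //; rewrite py0; clear -k0 ky; lia.
have n0 : (0 < n)%N by case: n {eu} ev => //; rewrite py0; clear -v0; lia.
have iy : (i%:Z <= y%:Z) by rewrite ey py_ge.
have yn : (y %| n)%N.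
  have yvz : (py a i * py a i %| py a n)%Z by rewrite -ey -ev.
  have /dvdnP[q eq] : (i %| n)%N.
    by apply: (@py_dvd a) => //; apply: dvdz_trans yvz; rewrite dvdz_mulr.
  by move: yvz; rewrite eq mulnC py_sqr_dvd // -ey => h; apply: dvdn_mull.
have yn' : (y <= n)%N by apply: dvdn_leq.
have h : (px a n %| px a i - px a j)%Z.
  move/eqmodz: m3; move/eqmodz: m2; rewrite ex es eu => /(px_congr j)[h1 _] h2.
  have -> : px a i - px a j = (px b j - px a j) - (px b j - px a i) by ring.
  by rewrite rpredB.
have {}h : (4 * y%:Z %| j%:Z - i%:Z)%Z \/ (4 * y%:Z %| j%:Z + i%:Z)%Z.
  have d4 : (4 * y%:Z %| 4 * n%:Z)%Z by rewrite dvdz_mul2l.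
  have [|h1|h1] := px_congr_index (i := i) a1' _ h; first by clear -i0 iy yn'; lia.
    by left; apply: dvdz_trans h1.
  by right; apply: dvdz_trans h1.
have tj : (4 * y%:Z %| t%:Z - j%:Z)%Z.
  rewrite et; apply: dvdz_trans (py_congr_index b j).
  by move/eqmodz: m1; rewrite PoszM.
have tk : (4 * y%:Z %| t%:Z - k%:Z)%Z by move/eqmodz: m4; rewrite PoszM.
have jk : (4 * y%:Z %| j%:Z - k%:Z)%Z.
  have -> : j%:Z - k%:Z = (t%:Z - k%:Z) - (t%:Z - j%:Z) by ring.
  by rewrite rpredB.
case: h => h.
  have : k%:Z - i%:Z = 0; last by clear; lia.
  apply: (@dvdz_small (4 * y%:Z)); last by clear -k0 ky iy i0; lia.
  have -> : k%:Z - i%:Z = (j%:Z - i%:Z) - (j%:Z - k%:Z) by ring.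
  by rewrite rpredB.
have : k%:Z + i%:Z = 0; last by clear -k0; lia.
apply: (@dvdz_small (4 * y%:Z)); last by clear -k0 ky iy i0; lia.
have -> : k%:Z + i%:Z = (j%:Z + i%:Z) - (j%:Z - k%:Z) by ring.
by rewrite rpredB.
Qed.

Lemma pell_nat (a k : nat) : (1 < a)%N -> exists x y : nat,
  [/\ x%:Z = px a k, y%:Z = py a k & (x * x + y * y = a * a * y * y + 1)%N].
Proof.
move=> a1; have a1' : (1 < a%:Z) by lia.
exists `|px a k|%N, `|py a k|%N.
have := px_gt0 k a1'; have := py_ge0 k a1'; have := pell_eq a k.
move: (px a k) (py a k) => x y e y0 x0.
by split; lia.
Qed.

Lemma pell_char_complete (a k x y : nat) : (1 < a)%N -> (0 < k)%N ->
  x%:Z = px a k -> y%:Z = py a k ->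
  (k <= y)%N /\ (x * x + y * y = a * a * y * y + 1)%N /\
  exists u v s t b : nat,
  (u * u + v * v = a * a * v * v + 1)%N /\
  (s * s + t * t = b * b * t * t + 1)%N /\ (1 < b)%N /\ (b = 1 %[mod 4 * y])%N /\
  (b = a %[mod u])%N /\ (0 < v)%N /\ (y * y %| v)%N /\ (s = x %[mod u])%N /\
  (t = k %[mod 4 * y])%N.
Proof.
move=> a1 k0 ex ey; have a1' : (1 < a%:Z) by lia.
have ky : (k <= y)%N by have := py_ge k a1'; rewrite -ey.
split=> //; split; first by have := pell_eq a k; rewrite -ex -ey; clear; lia.
have y0 : (0 < y)%N by clear -k0 ky; lia.
(* The factor [y] in the index yields [y * y %| v]; the factor 2 makes [v] even, hence [u] odd and
   coprime to [4 * y], as the Chinese remainder theorem requires for [b]. *)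
have [u [v [eu ev e]]] := pell_nat (k * (2 * y)) a1.
have yv : (y * y %| v)%N.
  have : (y%:Z * y%:Z %| v%:Z)%Z by rewrite ev ey py_sqr_dvd // -ey PoszM dvdz_mull.
  by rewrite -PoszM.
have v0 : (0 < v)%N.
  have := py_ge (k * (2 * y)) a1'; rewrite -ev.
  have : (0 < k * (2 * y))%N by rewrite !muln_gt0 k0 y0.
  by clear; lia.
have ev2 : ~~ odd v.
  have : v%:Z = 2 * (px a (k * y) * py a (k * y)).
    rewrite ev; have -> : (k * (2 * y) = k * y + k * y)%N by clear; lia.
    by rewrite pyD; ring.
  by move: (px _ _ * _) => z; clear; lia.
have uodd : odd u.
  have : odd (u * u + v * v) = odd (a * a * v * v + 1) by rewrite e.
  by rewrite !oddD !oddM (negbTE ev2) !andbF !addbF andbb.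
have cop : coprime u (4 * y).
  rewrite coprimeMr (@coprimeXr 2 u 2) ?coprimen2 //=.
  have : coprime u v by have := coprime_px_py a (k * (2 * y)); rewrite -eu -ev.
  by apply: coprime_dvdr; apply: dvdn_trans yv; apply: dvdn_mulr.
have u0 : (0 < u)%N by case: u uodd {eu e cop}.
(* The added multiple of both moduli only serves to make [b] larger than 1. *)
pose b := (chinese u (4 * y) a 1 + 2 * (u * (4 * y)))%N.
have bu : (b = a %[mod u])%N.
  by rewrite /b mulnCA -modnDmr modnMr addn0 chinese_modl.
have by_ : (b = 1 %[mod 4 * y])%N.
  by rewrite /b mulnA -modnDmr modnMl addn0 chinese_modr.
have b1 : (1 < b)%N.
  have : (0 < u * (4 * y))%N by rewrite !muln_gt0 u0 y0.
  by rewrite /b; move: (chinese _ _ _ _) (u * _)%N => c d; clear; lia.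
have [s [t [es et e3]]] := pell_nat k b1.
exists u, v, s, t, b; do 8 split=> //.
  apply/eqmodz; rewrite es ex; move/eqmodz: bu => /(px_congr k)[h _].
  exact: h.
apply/eqmodz; rewrite et; apply: dvdz_trans (py_congr_index b k).
by have /eqmodz := by_.
Qed.

End Pell.

(** * Diophantine predicates *)

Inductive pexp : Type :=
| PVar (i : nat)
| PCst (c : nat)
| PAdd (p q : pexp)
| PMul (p q : pexp).

Fixpoint peval (p : pexp) (v : nat -> nat) : nat :=
  match p with
  | PVar i => v i
  | PCst c => c
  | PAdd p q => peval p v + peval q v
  | PMul p q => peval p v * peval q v
  end.

Fixpoint pren (r : nat -> nat) (p : pexp) : pexp :=
  match p with
  | PVar i => PVar (r i)
  | PCst c => PCst c
  | PAdd p q => PAdd (pren r p) (pren r q)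
  | PMul p q => PMul (pren r p) (pren r q)
  end.

Lemma peval_ren r p v : peval (pren r p) v = peval p (fun i => v (r i)).
Proof. by elim: p => //= p -> q ->. Qed.

Definition cat_env (m : nat) (x v : nat -> nat) (i : nat) : nat :=
  if i < m then x i else v (i - m).

(** Coefficients are natural numbers, so an equation needs two sides. The [m] unknowns come first in
    the environment and the parameters follow. *)
Definition dio (P : (nat -> nat) -> Prop) : Prop :=
  exists (m : nat) (p q : pexp), forall v,
    P v <-> exists x, peval p (cat_env m x v) = peval q (cat_env m x v).

Definition dfun (f : (nat -> nat) -> nat) : Prop :=
  dio (fun v => v 0 = f (fun i => v i.+1)).

Lemma dio_ext (P Q : (nat -> nat) -> Prop) :
  (forall v, P v <-> Q v) -> dio P -> dio Q.
Proof. by move=> e [m [p [q h]]]; exists m, p, q => v; rewrite -e. Qed.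

Lemma dio_poly (p q : pexp) : dio (fun v => peval p v = peval q v).
Proof.
exists 0, p, q => v; have e x : cat_env 0 x v = v.
  by apply: funext => i; rewrite /cat_env subn0.
by split=> [h|[x]]; [exists (fun=> 0)|]; rewrite e.
Qed.

(* The renamings put two systems over disjoint blocks of unknowns. *)
Lemma cat_env_split m1 m2 x v :
  (fun i => cat_env (m1 + m2) x v (if i < m1 then i else i + m2)) = cat_env m1 x v /\
  (fun i => cat_env (m1 + m2) x v (if i < m2 then m1 + i else i + m1)) =
    cat_env m2 (fun i => x (m1 + i)) v.
Proof.
split; apply: funext => i; rewrite /cat_env; case: (ltnP i _) => h.
- by rewrite ltn_addr.
- by rewrite ltn_add2r ltnNge h subnDr.
- by rewrite ltn_add2l h.
- by rewrite (addnC i) ltn_add2l ltnNge h subnDl.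
Qed.

Lemma cat_env_join m1 m2 x1 x2 v :
  (fun i => cat_env (m1 + m2) (cat_env m1 x1 x2) v (if i < m1 then i else i + m2))
     = cat_env m1 x1 v /\
  (fun i => cat_env (m1 + m2) (cat_env m1 x1 x2) v (if i < m2 then m1 + i else i + m1))
     = cat_env m2 x2 v.
Proof.
have [-> ->] := cat_env_split m1 m2 (cat_env m1 x1 x2) v.
split; apply: funext => i; rewrite /cat_env; case: ltnP => // h.
by rewrite ltnNge leq_addr /= addKn.
Qed.

(** A vanishing sum of two squares, with the negative terms moved to the other side. *)
Lemma sqr_eq_nat (a b c d : nat) :
  (a = b /\ c = d) <-> a * a + b * b + (c * c + d * d) = 2 * (a * b) + 2 * (c * d).
Proof.
split=> [[-> ->]|e]; first by ring.
have h x y : 2 * (x * y) <= x * x + y * y by case/orP: (leq_total x y); nia.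
have := h a b; have := h c d => h1 h2; split; nia.
Qed.

Lemma dio_and (P Q : (nat -> nat) -> Prop) :
  dio P -> dio Q -> dio (fun v => P v /\ Q v).
Proof.
move=> [m1 [p1 [q1 h1]]] [m2 [p2 [q2 h2]]].
pose r1 i := if i < m1 then i else i + m2.
pose r2 i := if i < m2 then m1 + i else i + m1.
pose a := pren r1 p1; pose b := pren r1 q1; pose c := pren r2 p2; pose d := pren r2 q2.
exists (m1 + m2), (PAdd (PAdd (PMul a a) (PMul b b)) (PAdd (PMul c c) (PMul d d))),
  (PAdd (PMul (PCst 2) (PMul a b)) (PMul (PCst 2) (PMul c d))) => v.
rewrite h1 h2; split=> [[[x1 e1] [x2 e2]]|[x]].
  exists (cat_env m1 x1 x2) => /=; apply/sqr_eq_nat; rewrite !peval_ren.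
  by have [-> ->] := cat_env_join m1 m2 x1 x2 v.
rewrite /= => /sqr_eq_nat; rewrite !peval_ren.
have [-> ->] := cat_env_split m1 m2 x v => -[e1 e2].
by split; [exists x|exists (fun i => x (m1 + i))].
Qed.

Lemma dio_or (P Q : (nat -> nat) -> Prop) :
  dio P -> dio Q -> dio (fun v => P v \/ Q v).
Proof.
move=> [m1 [p1 [q1 h1]]] [m2 [p2 [q2 h2]]].
pose r1 i := if i < m1 then i else i + m2.
pose r2 i := if i < m2 then m1 + i else i + m1.
pose a := pren r1 p1; pose b := pren r1 q1; pose c := pren r2 p2; pose d := pren r2 q2.
(* A vanishing product of two differences, again without subtraction. *)
have key (s t u w : nat) : (s = t \/ u = w) <-> s * u + t * w = s * w + t * u.
  by split=> [|e]; [case=> ->; ring|nia].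
exists (m1 + m2), (PAdd (PMul a c) (PMul b d)), (PAdd (PMul a d) (PMul b c)) => v.
rewrite h1 h2; split=> [[[x e]|[x e]]|[x]].
- exists (cat_env m1 x x) => /=; apply/key; rewrite !peval_ren.
  by have [-> ->] := cat_env_join m1 m2 x x v; left.
- exists (cat_env m1 x x) => /=; apply/key; rewrite !peval_ren.
  by have [-> ->] := cat_env_join m1 m2 x x v; right.
rewrite /= => /key; rewrite !peval_ren.
by have [-> ->] := cat_env_split m1 m2 x v => -[e|e];
  [left; exists x|right; exists (fun i => x (m1 + i))].
Qed.

Lemma dio_ren (r : nat -> nat) (P : (nat -> nat) -> Prop) :
  dio P -> dio (fun v => P (fun i => v (r i))).
Proof.
move=> [m [p [q h]]]; pose r' i := if i < m then i else m + r (i - m).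
exists m, (pren r' p), (pren r' q) => v; rewrite h.
have e x : (fun i => cat_env m x v (r' i)) = cat_env m x (fun i => v (r i)).
  apply: funext => i; rewrite /cat_env /r'; case: (ltnP i m) => [-> //|_].
  by rewrite ltnNge leq_addr /= addKn.
by split=> -[x]; rewrite ?peval_ren ?e => h'; exists x; rewrite ?peval_ren ?e.
Qed.

Lemma dio_ex (P : nat -> (nat -> nat) -> Prop) :
  dio (fun v => P (v 0) (fun i => v i.+1)) -> dio (fun v => exists z, P z v).
Proof.
move=> [m [p [q h]]]; exists m.+1, p, q => v.
have e x z : cat_env m x (fun i => if i is j.+1 then v j else z) =
    cat_env m.+1 (fun i => if i < m then x i else z) v.
  apply: funext => i; rewrite /cat_env ltnS; case: (ltngtP i m) => [//||->].
    by move=> mi; rewrite -{1}(subnSK mi).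
  by rewrite subnn.
have e2 x : cat_env m.+1 x v = cat_env m.+1 (fun i => if i < m then x i else x m) v.
  by apply: funext => i; rewrite /cat_env ltnS; case: (ltngtP i m) => // ->.
split=> [[z hz]|[x hx]].
  have [/(_ hz)[x hx] _] := h (fun i => if i is j.+1 then v j else z).
  by exists (fun i => if i < m then x i else z); rewrite -e.
exists (x m); have [_] := h (fun i => if i is j.+1 then v j else x m); apply.
by exists x; rewrite e -e2.
Qed.

Lemma dfun_ren (r : nat -> nat) (f : (nat -> nat) -> nat) :
  dfun f -> dfun (fun v => f (fun i => v (r i))).
Proof. exact: (dio_ren (fun i => if i is j.+1 then (r j).+1 else 0)). Qed.

Lemma dio_let (f : (nat -> nat) -> nat) (P : nat -> (nat -> nat) -> Prop) :
  dfun f -> dio (fun v => P (v 0) (fun i => v i.+1)) -> dio (fun v => P (f v) v).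
Proof.
move=> df dP; apply: (dio_ext (P := fun v => exists z, z = f v /\ P z v)).
  by move=> v; split=> [[z [->]]|h] //; exists (f v).
by apply: dio_ex; apply: dio_and.
Qed.

Lemma dio_rel2 (R : nat -> nat -> Prop) f g :
  dio (fun v => R (v 0) (v 1)) -> dfun f -> dfun g -> dio (fun v => R (f v) (g v)).
Proof.
move=> dR df dg; apply: (@dio_let f (fun z v => R z (g v))) => //.
apply: (@dio_let (fun v => g (fun i => v i.+1)) (fun z v => R (v 0) z)).
  exact: dfun_ren.
exact: (dio_ren (fun i => if i is 0 then 1 else 0) dR).
Qed.

Lemma dio_rel3 (R : nat -> nat -> nat -> Prop) f g h :
  dio (fun v => R (v 0) (v 1) (v 2)) -> dfun f -> dfun g -> dfun h ->
  dio (fun v => R (f v) (g v) (h v)).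
Proof.
move=> dR df dg dh; apply: (@dio_let f (fun z v => R z (g v) (h v))) => //.
apply: (@dio_let (fun v => g (fun i => v i.+1))
  (fun z v => R (v 0) z (h (fun i => v i.+1)))); first exact: dfun_ren.
apply: (@dio_let (fun v => h (fun i => v i.+2)) (fun z v => R (v 1) (v 0) z)).
  exact: dfun_ren.
exact: (dio_ren (fun i => if i is i'.+1 then (if i' is 0 then 1 else 0) else 2) dR).
Qed.

Lemma dio_rel4 (R : nat -> nat -> nat -> nat -> Prop) f g h k :
  dio (fun v => R (v 0) (v 1) (v 2) (v 3)) -> dfun f -> dfun g -> dfun h -> dfun k ->
  dio (fun v => R (f v) (g v) (h v) (k v)).
Proof.
move=> dR df dg dh dk; apply: (@dio_let f (fun z v => R z (g v) (h v) (k v))) => //.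
apply: (@dio_let (fun v => g (fun i => v i.+1))
  (fun z v => R (v 0) z (h (fun i => v i.+1)) (k (fun i => v i.+1)))); first exact: dfun_ren.
apply: (@dio_let (fun v => h (fun i => v i.+2))
  (fun z v => R (v 1) (v 0) z (k (fun i => v i.+2)))); first exact: dfun_ren.
apply: (@dio_let (fun v => k (fun i => v i.+3)) (fun z v => R (v 2) (v 1) (v 0) z)).
  exact: dfun_ren.
exact: (dio_ren (fun i => nth 0 [:: 3; 2; 1; 0] i) dR).
Qed.

Lemma dfun_var i : dfun (fun v => v i).
Proof. exact: (dio_poly (PVar 0) (PVar i.+1)). Qed.

Lemma dfun_cst c : dfun (fun=> c).
Proof. exact: (dio_poly (PVar 0) (PCst c)). Qed.

Lemma dfun_comp1 (h : nat -> nat) f :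
  dio (fun v => v 0 = h (v 1)) -> dfun f -> dfun (fun v => h (f v)).
Proof.
move=> dh df; apply: (@dio_rel2 (fun a b => a = h b)) => //; first exact: dfun_var.
exact: dfun_ren.
Qed.

Lemma dfun_comp2 (h : nat -> nat -> nat) f g :
  dio (fun v => v 0 = h (v 1) (v 2)) -> dfun f -> dfun g -> dfun (fun v => h (f v) (g v)).
Proof.
move=> dh df dg; apply: (@dio_rel3 (fun a b c => a = h b c)) => //; first exact: dfun_var.
  exact: (dfun_ren (fun i => i.+1) df).
exact: dfun_ren.
Qed.

Lemma dfun_add f g : dfun f -> dfun g -> dfun (fun v => f v + g v).
Proof. exact/(@dfun_comp2 addn)/(dio_poly (PVar 0) (PAdd (PVar 1) (PVar 2))). Qed.

Lemma dfun_mul f g : dfun f -> dfun g -> dfun (fun v => f v * g v).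
Proof. exact/(@dfun_comp2 muln)/(dio_poly (PVar 0) (PMul (PVar 1) (PVar 2))). Qed.

Lemma dfun_succ f : dfun f -> dfun (fun v => (f v).+1).
Proof.
apply: (@dfun_comp1 succn).
by apply: dio_ext (dio_poly (PVar 0) (PAdd (PVar 1) (PCst 1))) => v /=; rewrite addn1.
Qed.

Lemma dio_eq f g : dfun f -> dfun g -> dio (fun v => f v = g v).
Proof. exact/(@dio_rel2 eq)/(dio_poly (PVar 0) (PVar 1)). Qed.

Lemma dio_le f g : dfun f -> dfun g -> dio (fun v => f v <= g v).
Proof.
apply: (@dio_rel2 (fun a b => a <= b)).
apply: (dio_ext (P := fun v => exists z, v 0 + z = v 1)) => [v|].
  by split=> [[z <-]|h]; [rewrite leq_addr|exists (v 1 - v 0); rewrite subnKC].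
by apply: dio_ex; apply: dio_eq; [apply: dfun_add|]; apply: dfun_var.
Qed.

Lemma dio_dvd f g : dfun f -> dfun g -> dio (fun v => f v %| g v).
Proof.
apply: (@dio_rel2 (fun a b => a %| b)).
apply: (dio_ext (P := fun v => exists z, v 1 = z * v 0)) => [v|].
  by split=> [[z ->]|/dvdnP//]; rewrite dvdn_mull.
by apply: dio_ex; apply: dio_eq; [|apply: dfun_mul]; apply: dfun_var.
Qed.

Lemma eqn_modP (a b m : nat) :
  a = b %[mod m] <-> exists p q, a + p * m = b + q * m.
Proof.
split=> [e|[p [q e]]]; last by rewrite -(modnMDl p a) addnC e addnC modnMDl.
exists (b %/ m), (a %/ m).
move: (divn_eq a m) (divn_eq b m); rewrite e.
by move: (a %/ m * m) (b %/ m * m) (b %% m) => x y z; lia.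
Qed.

Lemma dio_modeq f g h : dfun f -> dfun g -> dfun h -> dio (fun v => f v = g v %[mod h v]).
Proof.
apply: (@dio_rel3 (fun a b m => a = b %[mod m])).
apply: (dio_ext (P := fun v => exists p q, v 0 + p * v 2 = v 1 + q * v 2)) => [v|].
  by split=> /eqn_modP.
do 2 apply: dio_ex; apply: dio_eq; apply: dfun_add; try apply: dfun_mul; apply: dfun_var.
Qed.

(* Extended below with each new closure property. *)
Ltac dio_hook := fail.

Ltac dio_step :=
  cbv beta;
  lazymatch goal with
  | |- dio (fun _ => exists _, _) => apply: dio_ex
  | |- dio (fun _ => _ /\ _) => apply: dio_and
  | |- dio (fun _ => _ \/ _) => apply: dio_or
  | |- dio (fun _ => _ = _ %[mod _]) => apply: dio_modeq
  | |- dio (fun _ => is_true (_ %| _)) => apply: dio_dvd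
  | |- dio (fun _ => is_true (_ <= _)) => apply: dio_le
  | |- dio (fun _ => @eq nat _ _) => apply: dio_eq
  | |- dfun (fun v => v _) => apply: dfun_var
  | |- dfun (fun _ => ?c) => apply: dfun_cst
  | |- dfun (fun _ => addn _ _) => apply: dfun_add
  | |- dfun (fun _ => muln _ _) => apply: dfun_mul
  | |- dfun (fun _ => S _) => apply: dfun_succ
  | |- _ => first [dio_hook
      | match goal with H : dfun _ |- _ => first [exact H | exact: (dfun_ren _ H)] end]
  end.

Ltac dio_tac := repeat dio_step.

Lemma dfun_modn f g : dfun f -> dfun g -> dfun (fun v => f v %% g v).
Proof.
apply: (@dfun_comp2 modn).
apply: (dio_ext (P := fun v => v 0 = v 1 %[mod v 2] /\ (v 0 < v 2 \/ v 2 = 0))) => [v|].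
  split=> [[e [h|z]]|->].
  - by rewrite -e modn_small.
  - by move: e; rewrite z !modn0.
  - by rewrite modn_mod; split=> //; case: (v 2) => [|n]; [right|left; rewrite ltn_mod].
dio_tac.
Qed.

Lemma dfun_divn f g : dfun f -> dfun g -> dfun (fun v => f v %/ g v).
Proof.
apply: (@dfun_comp2 divn).
apply: (dio_ext (P := fun v => (v 2 = 0 /\ v 0 = 0) \/
    exists r, v 1 = v 0 * v 2 + r /\ r < v 2)) => [v|].
  split=> [[[-> ->]|[r [-> h]]]|->]; first by rewrite divn0.
    by rewrite divnMDl ?(leq_ltn_trans _ h) // divn_small // addn0.
  have [->|n0] := posnP (v 2); first by left; rewrite divn0.
  by right; exists (v 1 %% v 2); rewrite -divn_eq ltn_mod.
dio_tac.
Qed.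

Lemma dfun_sub f g : dfun f -> dfun g -> dfun (fun v => f v - g v).
Proof.
apply: (@dfun_comp2 subn).
apply: (dio_ext (P := fun v => (v 1 <= v 2 /\ v 0 = 0) \/ v 0 + v 2 = v 1)) => [v|].
  by split; lia.
dio_tac.
Qed.

Ltac dio_hook ::= first [apply: dfun_modn | apply: dfun_divn | apply: dfun_sub].

(** * Powers, binomial coefficients and factorials *)

Lemma posz_exp (n k : nat) : Posz (n ^ k) = (Posz n ^+ k)%R.
Proof. by elim: k => //= k IH; rewrite expnS exprS PoszM IH. Qed.

Definition pellrel (a k x y : nat) : Prop :=
  1 < a /\ Posz x = px a k /\ Posz y = py a k.

Lemma dio_pellrel f g h k : dfun f -> dfun g -> dfun h -> dfun k ->
  dio (fun v => pellrel (f v) (g v) (h v) (k v)).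
Proof.
apply: dio_rel4.
apply: (dio_ext (P := fun w => 1 < w 0 /\ ((w 1 = 0 /\ w 2 = 1 /\ w 3 = 0) \/
  (0 < w 1 /\ w 1 <= w 3 /\ w 2 * w 2 + w 3 * w 3 = w 0 * w 0 * w 3 * w 3 + 1 /\
   exists u v s t b : nat,
  u * u + v * v = w 0 * w 0 * v * v + 1 /\
  s * s + t * t = b * b * t * t + 1 /\ 1 < b /\ b = 1 %[mod 4 * w 3] /\
  b = w 0 %[mod u] /\ 0 < v /\ w 3 * w 3 %| v /\ s = w 2 %[mod u] /\
  t = w 1 %[mod 4 * w 3])))); last by dio_tac.
move=> w; move: (w 0) (w 1) (w 2) (w 3) => a k' x y; split.
  move=> [a1 [[-> [-> ->]]|[k0 [ky [e1 [u [v [s [t [b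
      [e2 [e3 [b1 [m1 [m2 [v0 [yv [m3 m4]]]]]]]]]]]]]]]]]].
    by split.
  by split=> //; apply: (@pell_char_sound a k' x y u v s t b) => //; rewrite k0.
move=> [a1 [ex ey]]; split=> //; have [k0|k0] := posnP k'.
  by left; move: ex ey; rewrite k0 px0 py0 => -[->] [->].
by right; split=> //; have := pell_char_complete a1 k0 ex ey.
Qed.

(** By [px_exp_congr] in the base [A + n.+1], the power is a residue modulo [t]. The first Pell
    relation only supplies a large base: [A] is at least [n.+2 ^ k], so that [n ^ k < t] and the
    residue determines the power. *)
Lemma pow_pell (n k m : nat) : 0 < n ->
  m = n ^ k <-> exists A Y X Y' : nat, pellrel n.+2 k A Y /\
    pellrel (A + n.+1) k X Y' /\
    let t := 2 * (A + n.+1) * n - n * n - 1 in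
    m < t /\ X + Y' * n = Y' * (A + n.+1) + m %[mod t].
Proof.
move=> n0; have bnd A Y : pellrel n.+2 k A Y -> n ^ k < 2 * (A + n.+1) * n - n * n - 1.
  move=> [_ [eA _]]; have := @px_expge n.+2 k isT; rewrite -eA -posz_exp => h.
  have le : n ^ k <= n.+2 ^ k by case: (k) => // k'; rewrite leq_exp2r // -addn2 leq_addr.
  have {}le : n ^ k <= A by apply: leq_trans le _; rewrite -lez_nat.
  by clear -le n0; nia.
have cong A X Y' : pellrel (A + n.+1) k X Y' ->
    X + Y' * n = Y' * (A + n.+1) + n ^ k %[mod 2 * (A + n.+1) * n - n * n - 1].
  move=> [_ [eX eY]]; apply/eqmodz.
  have := px_exp_congr (A + n.+1) n k; rewrite -eX -eY.
  have -> : Posz (2 * (A + n.+1) * n - n * n - 1) =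
      (2 * (A + n.+1)%:Z * n%:Z - n%:Z * n%:Z - 1)%R by clear -n0; nia.
  have -> // : (Posz (X + Y' * n)%N - Posz (Y' * (A + n.+1) + n ^ k)%N =
    X%:Z - ((A + n.+1)%:Z - n%:Z) * Y'%:Z - n%:Z ^+ k)%R.
  by rewrite !PoszD !PoszM posz_exp; ring.
split=> [->|[A [Y [X [Y' [p1 [p2 [mt e]]]]]]]].
  have [A [Y [eA eY _]]] := @pell_nat n.+2 k isT.
  have [|X [Y' [eX eY' _]]] := @pell_nat (A + n.+1) k; first by clear -n0; lia.
  have p1 : pellrel n.+2 k A Y by [].
  have p2 : pellrel (A + n.+1) k X Y' by split=> //; clear -n0; lia.
  by exists A, Y, X, Y'; do 3 split=> //; [exact: bnd p1|exact: cong].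
have := cong _ _ _ p2; rewrite e => /eqP; rewrite eqn_modDl.
by rewrite !modn_small // ?(bnd _ _ p1) // => /eqP.
Qed.

Lemma dfun_pow f g : dfun f -> dfun g -> dfun (fun v => f v ^ g v).
Proof.
apply: (@dfun_comp2 expn).
apply: (dio_ext (P := fun v => (v 1 = 0 /\ ((v 2 = 0 /\ v 0 = 1) \/ (0 < v 2 /\ v 0 = 0))) \/
  (0 < v 1 /\ exists A Y X Y' : nat, pellrel (v 1).+2 (v 2) A Y /\
    pellrel (A + (v 1).+1) (v 2) X Y' /\
    v 0 < 2 * (A + (v 1).+1) * v 1 - v 1 * v 1 - 1 /\
    X + Y' * v 1 = Y' * (A + (v 1).+1) + v 0
      %[mod 2 * (A + (v 1).+1) * v 1 - v 1 * v 1 - 1]))).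
  move=> v; move: (v 0) (v 1) (v 2) => m n k; split.
    move=> [[-> [[-> ->]|[k0 ->]]]|[n0 h]]; rewrite ?expn0 ?exp0n //.
    by apply/pow_pell.
  move=> ->; have [->|n0] := posnP n.
    by left; split=> //; have [->|k0] := posnP k; [left|right; rewrite exp0n].
  by right; split=> //; apply/pow_pell.
dio_tac; by apply: dio_pellrel; dio_tac.
Qed.

Ltac dio_hook ::= first [apply: dfun_pow | apply: dfun_modn | apply: dfun_divn |
  apply: dfun_sub].

Lemma base_digit (B : nat) (c : nat -> nat) (N k : nat) : (forall i, c i < B) ->
  (\sum_(i < N) c i * B ^ i) %/ B ^ k %% B = if k < N then c k else 0.
Proof.
elim: k c N => [|k IH] c [|N] hc; rewrite ?big_ord0 ?div0n ?mod0n //.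
  rewrite big_ord_recl expn0 muln1 divn1 -modnDmr.
  rewrite (eq_bigr (fun i : 'I_N => B * (c i.+1 * B ^ i))); last by move=> i _; rewrite expnS; ring.
  by rewrite -big_distrr /= modnMr addn0 modn_small.
rewrite ltnS -(IH (fun i => c i.+1)) // expnS divnMA; congr (_ %/ _ %% _).
rewrite big_ord_recl expn0 muln1.
rewrite (eq_bigr (fun i : 'I_N => B * (c i.+1 * B ^ i))); last by move=> i _; rewrite expnS; ring.
rewrite -big_distrr /= mulnC divnDMl ?divn_small ?add0n //.
exact: leq_ltn_trans (leq0n _) (hc 0).
Qed.

Lemma bin_le_exp n k : 'C(n, k) <= 2 ^ n.
Proof.
elim: n k => [|n IH] [|k]; rewrite ?bin0 ?expn_gt0 //.
by rewrite binS expnS mul2n -addnn leq_add.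
Qed.

(** The binomial coefficients are the digits of a power of [1 + B] in base [B], here
    [B = (2 ^ n).+1], which exceeds all of them. *)
Lemma bin_digits n k :
  'C(n, k) = ((2 ^ n).+2 ^ n) %/ ((2 ^ n).+1 ^ k) %% (2 ^ n).+1.
Proof.
have -> : (2 ^ n).+2 ^ n = \sum_(i < n.+1) 'C(n, i) * (2 ^ n).+1 ^ i.
  rewrite -[(2 ^ n).+2]add1n expnDn; apply: eq_bigr => i _.
  by rewrite exp1n mul1n.
rewrite (@base_digit _ (fun i => 'C(n, i))) => [|i]; last by rewrite ltnS bin_le_exp.
by case: ltnP => // h; rewrite bin_small.
Qed.

Lemma dfun_bin f g : dfun f -> dfun g -> dfun (fun v => 'C(f v, g v)).
Proof.
apply: (@dfun_comp2 binomial).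
apply: (dio_ext (P := fun v => v 0 =
  ((2 ^ v 1).+2 ^ v 1) %/ ((2 ^ v 1).+1 ^ v 2) %% (2 ^ v 1).+1)) => [v|].
  by rewrite -bin_digits.
dio_tac.
Qed.

Lemma ffact_le_exp r n : r ^_ n <= r ^ n.
Proof.
elim: n => [|n IH]; first by rewrite ffactn0.
by rewrite ffactnSr expnSr leq_mul // leq_subr.
Qed.

(** Each of the [n] factors of the falling factorial loses at most [n] out of [r], a relative loss
    of at most [n * n / r]; everything is multiplied by [r] to avoid the exponent [n - 1]. *)
Lemma exp_le_ffact r n : r ^ n.+1 <= r * r ^_ n + n * n * r ^ n.
Proof.
elim: n => [|n IH]; first by rewrite ffactn0 expn1; lia.
rewrite ffactnSr (expnS _ n.+1).
have h := ffact_le_exp r n; have e := expnS r n.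
move: (r ^ n.+1) (r ^ n) (r ^_ n) e IH h => a b c -> IH h.
have h1 : r * c * r <= r * c * (r - n + n) by rewrite leq_mul2l; apply/orP; right; clear; lia.
have h2 : r * (r * b) <= r * (r * c + n * n * b) by rewrite leq_mul2l IH orbT.
have h3 : n.+1 * (r * c) <= n.+1 * (r * b) by rewrite !leq_mul2l h !orbT.
by move: (r - n) h1 => d h1; clear -h1 h2 h3; lia.
Qed.

Lemma fact_div (n : nat) (r := (n * n * (n ^ n).+1).+1) : n`! = r ^ n %/ 'C(r, n).
Proof.
have er : r = (n * n * (n ^ n).+1).+1 by []; move: r er => r er.
have r0 : 0 < r by rewrite er.
have b0 : 0 < 'C(r, n).
  rewrite bin_gt0 er -mulnA; apply: leqW.
  by case: (n) => // k; apply: leq_pmulr.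
have e := bin_ffact r n; have up := ffact_le_exp r n.
have low := exp_le_ffact r n; have fl := ffact_le_exp n n; rewrite ffactnn in fl.
rewrite expnS in low.
have R0 : 0 < r ^ n by rewrite expn_gt0 r0.
apply/eqP; rewrite eqn_leq leq_divRL // mulnC e up /= -ltnS ltn_divLR //.
rewrite mulSn [n`! * _]mulnC e.
have Fr : n * n * (n`!).+1 < r by rewrite er ltnS leq_mul2l ltnS fl orbT.
have e2 : n`! * ('C(r, n) + r ^_ n) = (n`!).+1 * r ^_ n by rewrite mulnDr [_ * 'C(r, n)]mulnC e mulSn.
have F0 := fact_gt0 n.
rewrite -(ltn_pmul2l F0) e2.
move: {e e2 up b0 fl er} (r ^_ n) (r ^ n) R0 low n`! F0 Fr => c R R0 low F F0 Fr.
rewrite -(ltn_pmul2l r0).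
have h1 : F.+1 * (r * R) <= F.+1 * (r * c + n * n * R) by rewrite leq_mul2l low orbT.
have h2 : n * n * F.+1 * R < r * R by rewrite ltn_pmul2r.
by clear -h1 h2; lia.
Qed.

Lemma dfun_fact f : dfun f -> dfun (fun v => (f v)`!).
Proof.
apply: (@dfun_comp1 factorial).
apply: (dio_ext (P := fun v => exists r, r = (v 1 * v 1 * (v 1 ^ v 1).+1).+1 /\
  v 0 = r ^ v 1 %/ 'C(r, v 1))) => [v|].
  by rewrite fact_div; split=> [[r [-> ->]]|->] //; eexists; split.
dio_tac; by apply: dfun_bin; dio_tac.
Qed.

Ltac dio_hook ::= first [apply: dfun_pow | apply: dfun_bin | apply: dfun_fact |
  apply: dfun_modn | apply: dfun_divn | apply: dfun_sub].

(** * Bounded quantification *)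

Definition scons (k : nat) (v : nat -> nat) (i : nat) : nat := if i is j.+1 then v j else k.

Lemma peval_le p v w : (forall i, v i <= w i) -> peval p v <= peval p w.
Proof.
move=> h; elim: p => //= p IHp q IHq; [exact: leq_add|exact: leq_mul].
Qed.

Lemma peval_mod d p v w : (forall i, v i = w i %[mod d]) -> peval p v = peval p w %[mod d].
Proof.
move=> h; elim: p => //= p IHp q IHq.
  by rewrite -modnDm IHp IHq modnDm.
by rewrite -modnMm IHp IHq modnMm.
Qed.

Definition pairwise_coprime (y : nat) (d : nat -> nat) : Prop :=
  forall k l, k < l < y -> coprime (d k) (d l).

Lemma coprime_prod y d : pairwise_coprime y.+1 d -> coprime (\prod_(k < y) d k) (d y).
Proof.
move=> h; rewrite coprime_sym; apply: (big_ind (fun z => coprime (d y) z)).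
- exact: coprimen1.
- by move=> a b ha hb; rewrite coprimeMr ha.
- by move=> i _; rewrite coprime_sym h // ltn_ord ltnSn.
Qed.

Lemma eqmod_prod y d a b : pairwise_coprime y d ->
  (forall k, k < y -> a = b %[mod d k]) -> a = b %[mod \prod_(k < y) d k].
Proof.
elim: y => [|y IH] cop h; first by rewrite big_ord0 !modn1.
rewrite big_ord_recr /=; apply/eqP; rewrite chinese_remainder ?coprime_prod //.
rewrite h // eqxx andbT; apply/eqP; apply: IH => [k l /andP[kl ly]|k ky].
  by apply: cop; rewrite kl ltnW.
by apply: h; apply: ltnW.
Qed.

Lemma chinese_family y d (a : nat -> nat) : pairwise_coprime y d ->
  exists X, forall k, k < y -> X = a k %[mod d k].
Proof.
elim: y => [|y IH] cop; first by exists 0.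
have [|X hX] := IH; first by move=> k l /andP[kl ly]; apply: cop; rewrite kl ltnW.
have c := coprime_prod cop.
exists (chinese (\prod_(k < y) d k) (d y) X (a y)) => k.
rewrite ltnS leq_eqVlt => /orP[/eqP->|ky]; first exact: chinese_modr.
rewrite -(hX k ky); have dv : d k %| \prod_(k < y) d k.
  by rewrite (bigD1 (Ordinal ky)) //= dvdn_mulr.
by rewrite -(modn_dvdm _ dv) chinese_modl // modn_dvdm.
Qed.

(** With [N = Q`! * Q`!] this is [1 + N / (k + 1) = (N + k + 1) / (k + 1)]: the
    product over [k < y] is a binomial coefficient, [k = - N - 1] modulo the
    [k]-th modulus, and all prime factors exceed [Q]. *)
Definition modulus (Q k : nat) : nat := ((Q`! * Q`!) %/ k.+1).+1.

Lemma index_modulus Q y k : y <= Q -> k < y ->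
  k.+1 * modulus Q k = k.+1 + Q`! * Q`!.
Proof.
move=> yQ ky; rewrite /modulus mulnS mulnC divnK // dvdn_mull //.
by apply: dvdn_fact; rewrite /= (leq_trans ky).
Qed.

(** Why the factorial is squared: after division by [k.+1] a prime up to [Q] still divides the
    quotient, so it cannot divide the quotient plus 1. *)
Lemma modulus_prime_gt Q y p k : y <= Q -> k < y -> prime p -> p %| modulus Q k -> Q < p.
Proof.
move=> yQ ky pr pd; rewrite ltnNge; apply/negP => pQ.
have kQ : k < Q by apply: leq_trans ky yQ.
have : p %| (Q`! * Q`!) %/ k.+1.
  rewrite dvdn_divRL; last by rewrite dvdn_mull // dvdn_fact.
  by rewrite dvdn_mul // dvdn_fact // ?prime_gt0.
by move=> h; move: pd; rewrite /modulus -addn1 dvdn_addr // dvdn1 => /eqP e; move: pr; rewrite e.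
Qed.

Lemma modulus_gt1 Q y k : y <= Q -> k < y -> 1 < modulus Q k.
Proof.
move=> yQ ky; rewrite /modulus ltnS divn_gt0 //; apply: leq_trans (leq_trans ky yQ) _.
have := fact_geq Q; have := fact_gt0 Q.
move=> h1 h2; apply: leq_trans h2 _; rewrite leq_pmulr //.
Qed.

(** By [index_modulus] a common prime factor divides the difference of the two indices, which is
    smaller than [Q]. *)
Lemma modulus_coprime Q y : y <= Q -> pairwise_coprime y (modulus Q).
Proof.
move=> yQ k l /andP[kl ly]; have ky := ltn_trans kl ly.
rewrite /coprime; apply/negPn/negP => ne.
have g0 : 0 < gcdn (modulus Q k) (modulus Q l) by rewrite gcdn_gt0.
have pr : prime (pdiv (gcdn (modulus Q k) (modulus Q l))) by apply: pdiv_prime; rewrite ltn_neqAle eq_sym ne.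
have := pdiv_dvd (gcdn (modulus Q k) (modulus Q l)); rewrite dvdn_gcd => /andP[pk pl].
have big := modulus_prime_gt yQ ky pr pk.
have hk : pdiv (gcdn (modulus Q k) (modulus Q l)) %| k.+1 + Q`! * Q`! by rewrite -(index_modulus yQ) // dvdn_mull.
have : pdiv (gcdn (modulus Q k) (modulus Q l)) %| (l.+1 + Q`! * Q`!) - (k.+1 + Q`! * Q`!).
  by apply: dvdn_sub => //; rewrite -(index_modulus yQ) // dvdn_mull.
rewrite subnDr subSS => /dvdn_leq; rewrite subn_gt0 kl => /(_ isT) le.
by move: big; rewrite ltnNge (leq_trans le) // (leq_trans (leq_subr _ _)) // ltnW // (leq_trans ly).
Qed.

Lemma bin_modulus_prod Q y : y <= Q ->
  'C(Q`! * Q`! + y, y) = \prod_(k < y) modulus Q k.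
Proof.
move=> yQ; have : forall z, z <= y -> 'C(Q`! * Q`! + z, z) = \prod_(k < z) modulus Q k; last by apply.
elim=> [|z IH] zy; first by rewrite big_ord0 bin0.
rewrite big_ord_recr /= -IH; last exact: ltnW.
apply/eqP; rewrite -(eqn_pmul2l (ltn0Sn z)) mulnCA (index_modulus yQ) //.
by rewrite addnS -mul_bin_diag /= mulnC addSn (addnC z).
Qed.

(** Polynomials with natural coefficients are monotone, so this bounds both sides for all [k <= y]
    and unknowns up to [u]; the remaining terms make it exceed [u] and reach [y]. *)
Definition ball_bound (m : nat) (p q : pexp) (u y : nat) (w : nat -> nat) : nat :=
  peval p (cat_env m (fun=> u) (scons y w)) + peval q (cat_env m (fun=> u) (scons y w))
    + u + y + 1.

Lemma ball_boundP m p q u y w (Q := ball_bound m p q u y w) :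
  [/\ peval p (cat_env m (fun=> u) (scons y w)) < Q,
      peval q (cat_env m (fun=> u) (scons y w)) < Q, u < Q & y <= Q].
Proof.
by rewrite /Q /ball_bound; move: (peval p _) (peval q _) => a b; split; lia.
Qed.

(** A single divisibility thus bounds the residues of [X] modulo every prime factor of a modulus;
    [dvd_bin_of_mod] is the converse. *)
Lemma prime_dvd_bin p X u : prime p -> p %| 'C(X, u.+1) -> exists2 i, i <= u & X = i %[mod p].
Proof.
move=> pr pd; have [Xu|uX] := leqP X u; first by exists X.
have : p %| X ^_ u.+1 by rewrite -bin_ffact dvdn_mulr.
rewrite ffact_prod Euclid_dvd_prod // big_has_cond => /hasP[i _ /= h].
have iu : i <= u by rewrite -ltnS.
exists i => //; apply/eqP; rewrite eqn_mod_dvd //.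
exact: leq_trans iu (ltnW uX).
Qed.

Lemma prime_dvd_fact p n : prime p -> p %| n`! -> p <= n.
Proof.
move=> pr; elim: n => [|n IH]; first by rewrite fact0 dvdn1 => /eqP e; rewrite e in pr.
by rewrite factS Euclid_dvdM // => /orP[/dvdn_leq-> //|/IH/leqW].
Qed.

Lemma dvd_bin_of_mod d X u i : i <= u -> X = i %[mod d] -> coprime d (u.+1)`! ->
  d %| 'C(X, u.+1).
Proof.
move=> iu e cop; have [Xu|uX] := leqP X u; first by rewrite bin_small.
rewrite -(Gauss_dvdl _ cop) bin_ffact ffact_prod.
rewrite (bigD1 (Ordinal (iu : i < u.+1))) //= dvdn_mulr //.
by rewrite -eqn_mod_dvd ?e // (leq_trans iu) // ltnW.
Qed.

Lemma cat_env_le m x u k y w : (forall j, j < m -> x j <= u) -> k <= y ->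
  forall i, cat_env m x (scons k w) i <= cat_env m (fun=> u) (scons y w) i.
Proof.
move=> h ky i; rewrite /cat_env; case: ltnP => [/h//|_].
by case: (i - m).
Qed.

Lemma cat_env_mod d m x X k D w : (forall j, j < m -> x j = X j %[mod d]) ->
  k = D %[mod d] ->
  forall i, cat_env m x (scons k w) i = cat_env m X (scons D w) i %[mod d].
Proof.
move=> h e i; rewrite /cat_env; case: ltnP => [/h//|_].
by case: (i - m).
Qed.

Lemma ball_core m p q y w :
  (forall k, k < y -> exists x, peval p (cat_env m x (scons k w)) =
                                peval q (cat_env m x (scons k w))) <->
  exists u X, let Q := ball_bound m p q u y w in let N := Q`! * Q`! in
    let M := 'C(N + y, y) in let D := M * N.+1 - N.+1 in
    (forall j, j < m -> M %| 'C(X j, u.+1)) /\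
    peval p (cat_env m X (scons D w)) = peval q (cat_env m X (scons D w)) %[mod M].
Proof.
(* [D] is a natural number congruent to [- (N + 1)] modulo [M], hence to [k] modulo the [k]-th
   modulus. *)
have index u k (Q := ball_bound m p q u y w) (N := Q`! * Q`!)
    (D := 'C(N + y, y) * N.+1 - N.+1) d :
    k < y -> y <= Q -> d %| modulus Q k -> k = D %[mod d].
  move=> ky yQ dd; apply/eqP; rewrite -(eqn_modDr N.+1) {}/D subnK; last first.
    by rewrite leq_pmull // bin_gt0 leq_addl.
  rewrite addnS -addSn -(index_modulus yQ ky) bin_modulus_prod // (bigD1 (Ordinal ky)) //=.
  have h1 := dvdn_mull k.+1 dd; rewrite /dvdn in h1; rewrite (eqP h1) eq_sym.
  by apply: dvdn_mulr; apply: dvdn_mulr.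
have yQ u : y <= ball_bound m p q u y w by have [] := ball_boundP m p q u y w.
have uQ u : u < ball_bound m p q u y w by have [] := ball_boundP m p q u y w.
split=> [h|[u [X [hX e]]] k ky]; last first.
  set Q := ball_bound _ _ _ _ _ _ in hX e; set N := Q`! * _ in hX e.
  (* One prime factor [r] of the modulus suffices: residues modulo [r] are at most [u], both sides
     are then below [Q < r], and congruence modulo [r] is equality. *)
  have gt1 := modulus_gt1 (yQ u) ky; have pr := pdiv_prime gt1.
  set r := pdiv _ in pr; have rd : r %| modulus Q k by apply: pdiv_dvd.
  have big := modulus_prime_gt (yQ u) ky pr rd; rewrite -/Q in big.
  have rM : r %| 'C(N + y, y).
    by apply: dvdn_trans rd _; rewrite bin_modulus_prod ?yQ // (bigD1 (Ordinal ky)) //= dvdn_mulr.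
  have small j : j < m -> X j %% r <= u.
    move=> jm; have [i iu ->] := prime_dvd_bin pr (dvdn_trans rM (hX j jm)).
    exact: leq_trans (leq_mod _ _) iu.
  exists (fun j => X j %% r).
  have := cat_env_le w small (ltnW ky) => le.
  have := @cat_env_mod r m (fun j => X j %% r) X k _ w _ (index u k r ky (yQ u) rd) => cong.
  have {}cong := cong (fun j _ => modn_mod _ _).
  have : peval p (cat_env m (fun j => X j %% r) (scons k w)) =
         peval q (cat_env m (fun j => X j %% r) (scons k w)) %[mod r].
    rewrite (peval_mod p cong) (peval_mod q cong).
    by rewrite -(modn_dvdm _ rM) e modn_dvdm.
  have [bp bq _ _] := ball_boundP m p q u y w.
  rewrite !modn_small //.
    by apply: leq_ltn_trans (peval_le q le) (ltn_trans bq big).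
  by apply: leq_ltn_trans (peval_le p le) (ltn_trans bp big).
have [x hx] : exists x : nat -> nat -> nat, forall k, k < y ->
    peval p (cat_env m (x k) (scons k w)) = peval q (cat_env m (x k) (scons k w)).
  have h' k : exists x, k < y -> peval p (cat_env m x (scons k w)) =
      peval q (cat_env m x (scons k w)).
    by case: (ltnP k y) => [/h[x ?]|_]; [exists x|exists id].
  by have [x hx] := choice h'; exists x.
pose u := \max_(k < y) \max_(j < m) x k j.
have xu k j : k < y -> j < m -> x k j <= u.
  move=> ky jm; apply: leq_trans (leq_bigmax (Ordinal ky)).
  exact: (@leq_bigmax _ (fun j : 'I_m => x k j) (Ordinal jm)).
have cop := modulus_coprime (yQ u); set Q := ball_bound _ _ _ _ _ _ in cop.
have [X hX] : exists X : nat -> nat, forall j k, k < y -> X j = x k j %[mod modulus Q k].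
  have hc j : exists z, forall k, k < y -> z = x k j %[mod modulus Q k].
    exact: (chinese_family (fun k => x k j) cop).
  by have [X hX] := choice hc; exists X.
exists u, X; rewrite -/Q /=; set N := Q`! * _; split.
  move=> j jm; rewrite bin_modulus_prod ?yQ //.
  suff : 'C(X j, u.+1) = 0 %[mod \prod_(k < y) modulus Q k].
    by move=> h'; rewrite /dvdn h' mod0n.
  apply: eqmod_prod => // k ky; rewrite mod0n; apply/eqP.
  apply: (@dvd_bin_of_mod _ _ _ (x k j)); [exact: xu|exact: hX|].
  rewrite coprime_sym; apply/negPn/negP => ne.
  have g1 : 1 < gcdn (u.+1)`! (modulus Q k).
    by rewrite ltn_neqAle eq_sym ne gcdn_gt0 fact_gt0.
  have pr := pdiv_prime g1; have := pdiv_dvd (gcdn (u.+1)`! (modulus Q k)).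
  rewrite dvdn_gcd => /andP[p1 p2]; have := modulus_prime_gt (yQ u) ky pr p2.
  have : pdiv (gcdn (u.+1)`! (modulus Q k)) <= u.+1 by apply: prime_dvd_fact.
  by move=> le; rewrite ltnNge (leq_trans le) // uQ.
set D := _ - N.+1; rewrite bin_modulus_prod ?yQ //; apply: eqmod_prod => // k ky.
have cong := cat_env_mod w (fun j jm => hX j k ky) (esym (index u k _ ky (yQ u) (dvdnn _))).
apply: etrans (peval_mod p (cong m)) _; rewrite hx //.
exact: esym (peval_mod q (cong m)).
Qed.

Lemma dio_exs (m : nat) (P : (nat -> nat) -> Prop) :
  dio P -> dio (fun v => exists X, P (cat_env m X v)).
Proof.
move=> [m' [p [q h]]]; exists (m' + m), p, q => v.
have e x X : cat_env m' x (cat_env m X v) = cat_env (m' + m) (cat_env m' x X) v.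
  apply: funext => i; rewrite /cat_env; case: (ltnP i m') => h1; first by rewrite ltn_addr.
  by rewrite ltn_subLR // subnDA.
have e2 x : cat_env (m' + m) x v = cat_env m' x (cat_env m (fun i => x (m' + i)) v).
  apply: funext => i; rewrite /cat_env; case: (ltnP i m') => h1; first by rewrite ltn_addr.
  by rewrite ltn_subLR // subnKC // subnDA.
split=> [[X /h[x hx]]|[x hx]]; first by exists (cat_env m' x X); rewrite -e.
by exists (fun i => x (m' + i)); apply/h; exists x; rewrite -e2.
Qed.

Lemma dio_fin (m : nat) (P : nat -> (nat -> nat) -> Prop) :
  (forall j, dio (P j)) -> dio (fun v => forall j, j < m -> P j v).
Proof.
move=> dP; elim: m => [|m IH].
  by apply: (dio_ext _ (dio_poly (PCst 0) (PCst 0))) => v.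
apply: (dio_ext _ (dio_and IH (dP m))) => v; split=> [[h1 h2] j|h].
  by rewrite ltnS leq_eqVlt => /orP[/eqP->|/h1].
by split=> [j jm|]; apply: h; rewrite ?ltnS // ltnW.
Qed.

Lemma dfun_peval p (F : nat -> (nat -> nat) -> nat) :
  (forall i, dfun (F i)) -> dfun (fun v => peval p (fun i => F i v)).
Proof.
move=> dF; elim: p => /= [i|c|p IHp q IHq|p IHp q IHq] //.
- exact: dfun_cst.
- exact: dfun_add.
- exact: dfun_mul.
Qed.

Lemma dio_ball_var (P : nat -> (nat -> nat) -> Prop) :
  dio (fun v => P (v 0) (fun i => v i.+1)) ->
  dio (fun v => forall k, k < v 0 -> P k (fun i => v i.+1)).
Proof.
move=> [m [p [q h]]].
(* In [e] the unknowns X_0, ..., X_(m-1) are followed by the bound u, then by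
   the number y of moduli and the parameters. *)
pose F (f : (nat -> nat) -> nat) (i : nat) (e : nat -> nat) :=
  if i < m then e i else if i == m then f e else e i.+1.
pose G (i : nat) (e : nat -> nat) := if i < m then e m else e i.+1.
pose Q e := peval p (fun i => G i e) + peval q (fun i => G i e) + e m + e m.+1 + 1.
pose N e := (Q e)`! * (Q e)`!.
pose M e := 'C(N e + e m.+1, e m.+1).
pose D e := M e * (N e).+1 - (N e).+1.
have dQ : dfun Q.
  have dG i : dfun (G i) by rewrite /G; case: (i < m); apply: dfun_var.
  by rewrite /Q; dio_tac; apply: dfun_peval.
have dN : dfun N by rewrite /N; dio_tac.
have dM : dfun M by rewrite /M; dio_tac.
have dD : dfun D by rewrite /D; dio_tac.
have dF i : dfun (F D i) by rewrite /F; case: (i < m); [|case: (i == m)]; dio_tac.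
pose cond e := (forall j, j < m -> M e %| 'C(e j, (e m).+1)) /\
  peval p (fun i => F D i e) = peval q (fun i => F D i e) %[mod M e].
have dc : dio cond.
  apply: dio_and; first by apply: dio_fin => j; dio_tac.
  by dio_tac; apply: dfun_peval.
pose R u (v : nat -> nat) := exists X, cond (cat_env m X (scons u v)).
have dR : dio (fun v => R (v 0) (fun i => v i.+1)).
  apply: dio_ext (dio_exs m dc) => v.
  by have -> : v = scons (v 0) (fun i => v i.+1) by apply: funext => -[].
apply: dio_ext (dio_ex dR) => v; set w := fun i => v i.+1; set y := v 0.
have e0 u X : cat_env m X (scons u v) m = u by rewrite /cat_env ltnn subnn.
have e1 u X : cat_env m X (scons u v) m.+1 = y by rewrite /cat_env ltnNge leqnSn subSnn.
have e2 u X i : m <= i -> cat_env m X (scons u v) i.+1 = v (i - m).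
  by move=> mi; rewrite /cat_env ltnNge ltnW //= subSn.
have eG u X : (fun i => G i (cat_env m X (scons u v))) = cat_env m (fun=> u) (scons y w).
  apply: funext => i; rewrite /G [in RHS]/cat_env; case: (ltnP i m) => // mi.
  by rewrite e2 //; case: (i - m).
have eF u X : (fun i => F D i (cat_env m X (scons u v))) =
    cat_env m X (scons (D (cat_env m X (scons u v))) w).
  apply: funext => i; rewrite /F [in RHS]/cat_env; case: (ltnP i m) => mi.
    by rewrite /cat_env mi.
  case: eqVneq => [->|ne]; first by rewrite subnn.
  rewrite e2 //; have : 0 < i - m by rewrite subn_gt0 ltn_neqAle eq_sym ne.
  by case: (i - m).
have eQ u X : Q (cat_env m X (scons u v)) = ball_bound m p q u y w.
  by rewrite /Q eG e0 e1.
have hP k : P k w <-> exists x, peval p (cat_env m x (scons k w)) = peval q (cat_env m x (scons k w)).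
  exact: (h (scons k w)).
have core := ball_core m p q y w.
have -> : (forall k, k < y -> P k w) <-> (forall k, k < y -> exists x,
    peval p (cat_env m x (scons k w)) = peval q (cat_env m x (scons k w))).
  by split=> h' k /h'/hP.
rewrite core; split=> -[u [X hX]]; exists u, X; move: hX;
  rewrite /cond eF /D /M /N eQ e0 e1 /=; case=> h1 h2; split=> // j jm; move: (h1 j jm);
  by rewrite /cat_env jm.
Qed.

Lemma dio_ball f (P : nat -> (nat -> nat) -> Prop) :
  dfun f -> dio (fun v => P (v 0) (fun i => v i.+1)) ->
  dio (fun v => forall k, k < f v -> P k v).
Proof.
move=> df dP; apply: (@dio_let f (fun y v => forall k, k < y -> P k v) df).
exact: dio_ball_var.
Qed.

(** * Recursive functions are Diophantine *)

Lemma dio_fin_ord (k : nat) (P : 'I_k -> (nat -> nat) -> Prop) :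
  (forall i, dio (P i)) -> dio (fun v => forall i, P i v).
Proof.
move=> dP; pose P' j v := if insub j is Some i then P i v else True.
have dP' j : dio (P' j).
  rewrite /P'; case: insub => [i|]; first exact: dP.
  by apply: (dio_ext _ (dio_poly (PCst 0) (PCst 0))) => v.
apply: dio_ext (dio_fin k dP') => v; split=> [h i|h j jk].
  by have := h i (ltn_ord i); rewrite /P' valK.
by rewrite /P' insubT.
Qed.

(** Goedel's beta function, with the moduli of the bounded quantifier; the summand with the maximum
    makes them exceed all the values. *)
Lemma beta_coding (s : nat -> nat) (N : nat) :
  exists c Q, forall i, i <= N -> c %% modulus Q i = s i.
Proof.
pose Q := N.+1 + \max_(i < N.+1) s i.
have [c hc] := chinese_family s (@modulus_coprime Q N.+1 (leq_addr _ _)).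
exists c, Q => i iN; rewrite hc // modn_small // ltnS.
have siQ : s i <= Q.
  apply: leq_trans (leq_addl _ _).
  exact: (@leq_bigmax _ (fun i : 'I_N.+1 => s i) (Ordinal (iN : i < N.+1))).
rewrite leq_divRL // leq_mul //; first exact: leq_trans siQ (fact_geq Q).
by apply: leq_trans (fact_geq Q); rewrite /Q addSn ltnS (leq_trans iN) // leq_addr.
Qed.

Lemma prim_recP (base : nat -> Prop) step i y :
  prim_rec base step i y <-> exists s : nat -> nat,
    base (s 0) /\ (forall j, j < i -> step j (s j) (s j.+1)) /\ s i = y.
Proof.
elim: i y => [|i IH] y /=.
  by split=> [h|[s [h [_ <-]]]] //; exists (fun=> y); split=> //; split.
split=> [[z [/IH[s [b [st e]]] h]]|[s [b [st e]]]].
  exists (fun j => if j <= i then s j else y); split=> //; split; last by rewrite ltnn.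
  move=> j; rewrite ltnS => ji; rewrite ji; case: ltnP => ij; first exact: st.
  by have -> : j = i by [apply/eqP; rewrite eqn_leq ji]; rewrite e.
exists (s i); split; last by rewrite -e; apply: st.
by apply/IH; exists s; split=> //; split=> // j ji; apply: st; apply: ltnW.
Qed.

Lemma behead_mktuple n (F : 'I_n.+1 -> nat) :
  behead_tuple (mktuple F) = mktuple (fun i => F (lift ord0 i)).
Proof.
by apply: eq_from_tnth => i; rewrite tnth_behead !tnth_mktuple; congr F; apply: val_inj;
  rewrite /= inordK // ltnS.
Qed.

Definition fcons n T (x : T) (F : 'I_n -> T) (i : 'I_n.+1) : T :=
  if unlift ord0 i is Some j then F j else x.

Lemma cons_mktuple n x (F : 'I_n -> nat) :
  [tuple of x :: mktuple F] = mktuple (fcons x F).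
Proof.
apply: eq_from_tnth => i; rewrite tnth_mktuple /fcons; case: unliftP => [j ->|->].
  by rewrite tnthS tnth_mktuple.
by rewrite tnth0.
Qed.

Lemma cons_cons_behead n x y (F : 'I_n.+1 -> nat) :
  [tuple of x :: y :: behead_tuple (mktuple F)] =
  mktuple (fcons x (fcons y (fun i => F (lift ord0 i)))).
Proof.
rewrite -cons_mktuple -[mktuple (fcons y _)]cons_mktuple -behead_mktuple.
exact: val_inj.
Qed.

Lemma ra_eval_rec n (f : recalg n) h (F : 'I_n.+1 -> nat) y :
  ra_eval (ra_rec f h) (mktuple F) y <->
  prim_rec (ra_eval f (mktuple (fun i => F (lift ord0 i))))
    (fun j z => ra_eval h (mktuple (fcons j (fcons z (fun i => F (lift ord0 i))))))
    (F ord0) y.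
Proof.
have e : (fun j z => ra_eval h (mktuple (fcons j (fcons z (fun i => F (lift ord0 i)))))) =
    (fun j z => ra_eval h [tuple of j :: z :: behead_tuple (mktuple F)]).
  by apply: funext => j; apply: funext => z; rewrite cons_cons_behead.
by rewrite e -behead_mktuple -[F ord0](tnth_mktuple F).
Qed.

Lemma fcons_app n (A T : Type) (x : A -> T) (F : 'I_n -> A -> T) a :
  (fun i => fcons x F i a) = fcons (x a) (fun i => F i a).
Proof. by apply: funext => i; rewrite /fcons; case: unlift. Qed.

Lemma dfun_fcons n (x : (nat -> nat) -> nat) F (i : 'I_n.+1) :
  dfun x -> (forall i, dfun (F i)) -> dfun (fcons x F i).
Proof. by move=> dx dF; rewrite /fcons; case: unlift. Qed.

(** Arguments and value are arbitrary Diophantine functions, so that the induction hypothesis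
    applies under new quantifiers. Composition quantifies the intermediate values, recursion a beta
    code of the whole history, and minimisation uses a bounded quantifier. *)
Theorem dio_recalg n (f : recalg n) (F : 'I_n -> (nat -> nat) -> nat) g :
  (forall i, dfun (F i)) -> dfun g ->
  dio (fun v => ra_eval f (mktuple (fun i => F i v)) (g v)).
Proof.
elim: f F g => {n} [n|| n i|n k f IHf h IHh|n f IHf h IHh|n f IHf] F g dF dg.
- by rewrite /=; dio_tac.
- apply: (dio_ext (P := fun v => g v = (F ord0 v).+1)) => [v|].
    by rewrite /= /thead tnth_mktuple.
  by have dF0 := dF ord0; dio_tac.
- apply: (dio_ext (P := fun v => g v = F i v)) => [v|]; first by rewrite /= tnth_mktuple.
  by have dFi := dF i; dio_tac.
- pose P e := (forall i : 'I_k, ra_eval (h i) (mktuple (fun j => F j (fun t => e (k + t)))) (e i))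
    /\ ra_eval f (mktuple (fun i : 'I_k => e i)) (g (fun t => e (k + t))).
  have sh e X : (fun t => cat_env k X e (k + t)) = e.
    by apply: funext => t; rewrite /cat_env ltnNge leq_addr /= addKn.
  apply: (dio_ext (P := fun v => exists X, P (cat_env k X v))) => [v|].
    split=> [[X]|[w [h1 h2]]].
      rewrite /P sh => -[h1 h2]; exists (mktuple (fun i : 'I_k => cat_env k X v i)); split=> // i.
      by rewrite tnth_mktuple; exact: h1.
    exists (nth 0 w); rewrite /P sh; have e (i : 'I_k) : cat_env k (nth 0 w) v i = tnth w i.
      by rewrite /cat_env ltn_ord (tnth_nth 0).
    split=> [i|]; first by rewrite e; exact: h1.
    rewrite (_ : mktuple _ = w); first exact: h2.
    by apply: eq_from_tnth => i; rewrite tnth_mktuple.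
  apply: dio_exs; apply: dio_and; first apply: dio_fin_ord => i.
    by apply: IHh; [move=> j; apply: dfun_ren|apply: dfun_var].
  by apply: IHf; [move=> j; apply: dfun_var|apply: dfun_ren].
(* This is [c %% modulus Q i], unfolded into operations that [dio_tac] recognises. *)
- pose beta c Q i := c %% ((Q`! * Q`!) %/ i.+1).+1.
  pose T v := F ord0 v; pose F' i := F (lift ord0 i).
  have dT : dfun T by exact: dF.
  have dF' i : dfun (F' i) by exact: dF.
  apply: (dio_ext (P := fun v => exists c Q,
    ra_eval f (mktuple (fun i => F' i v)) (beta c Q 0) /\
    (forall j, j < T v -> ra_eval h (mktuple (fcons j (fcons (beta c Q j) (fun i => F' i v))))
       (beta c Q j.+1)) /\ beta c Q (T v) = g v)) => [v|].
    rewrite ra_eval_rec prim_recP -/(T v); split=> [[c [Q [h1 [h2 h3]]]]|].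
      by exists (beta c Q).
    move=> [s [h1 [h2 h3]]]; have [c [Q hc]] := beta_coding s (T v).
    exists c, Q; have e i : i <= T v -> beta c Q i = s i by apply: hc.
    rewrite !e //; split=> //; split=> // j jT; rewrite !e ?(ltnW jT) //.
    exact: h2.
  do 2 apply: dio_ex; apply: dio_and; first apply: IHf.
  - by move=> i; apply: (dfun_ren _ (dF' i)).
  - by rewrite /beta; dio_tac.
  apply: dio_and; last by rewrite /beta; dio_tac.
  apply: dio_ball; first by dio_tac.
  pose x0 (v : nat -> nat) := v 0; pose x1 (v : nat -> nat) := beta (v 2) (v 1) (v 0).
  pose G := fcons x0 (fcons x1 (fun i v => F' i (fun t => v t.+3))).
  have dG i : dfun (G i).
    apply: dfun_fcons => [|j]; first exact: dfun_var.
    apply: dfun_fcons => [|j']; first by rewrite /x1 /beta; dio_tac.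
    exact: (dfun_ren _ (dF' j')).
  have dg' : dfun (fun v => beta (v 2) (v 1) (v 0).+1) by rewrite /beta; dio_tac.
  by apply: (dio_ext _ (IHh G _ dG dg')) => v; rewrite /G !fcons_app.
- rewrite /=; apply: dio_and.
    have dG i : dfun (fcons g F i) by apply: dfun_fcons.
    apply: (dio_ext _ (IHf _ _ dG (dfun_cst 0))) => v.
    by rewrite fcons_app cons_mktuple.
  apply: dio_ball => //; apply: dio_ex.
  pose x0 (v : nat -> nat) := v 1; pose G := fcons x0 (fun i v => F i (fun t => v t.+2)).
  have dG i : dfun (G i).
    apply: dfun_fcons => [|j]; first exact: dfun_var.
    exact: (dfun_ren _ (dF j)).
  apply: (dio_ext _ (IHf G _ dG (dfun_succ (dfun_var 0)))) => v.
  by rewrite /G fcons_app cons_mktuple.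
Qed.

(** * Sums of four squares *)

Section FourSquares.

Local Open Scope ring_scope.

Definition four_squares (n : int) : Prop :=
  exists a b c d : int, n = a * a + b * b + c * c + d * d.

(** Euler's identity, the multiplicativity of the norm of quaternions. *)
Lemma four_squaresM m n : four_squares m -> four_squares n -> four_squares (m * n).
Proof.
move=> [a [b [c [d ->]]]] [a' [b' [c' [d' ->]]]].
exists (a * a' + b * b' + c * c' + d * d'), (a * b' - b * a' + c * d' - d * c'),
  (a * c' - c * a' + d * b' - b * d'), (a * d' - d * a' + b * c' - c * b'); ring.
Qed.

Lemma nearest_multiple (a m : int) : 0 < m -> exists k, - m <= 2 * (a - m * k) < m.
Proof.
move=> m0; exists ((2 * a + m) %/ (2 * m))%Z.
have m20 : 2 * m != 0 by lia.
have := divz_eq (2 * a + m) (2 * m); have := modz_ge0 (2 * a + m) m20.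
have := @ltz_pmod (2 * a + m) (2 * m) ltac:(lia).
by move: (_ %/ _)%Z (_ %% _)%Z => q r; lia.
Qed.

(** One step of Lagrange's descent: dividing the product of a representation of
    [m p] by the representation of its reduction modulo [m]. *)
Lemma four_squares_descent (m p : int) : 1 < m -> ~ (m %| p)%Z -> four_squares (m * p) ->
  exists m', 0 < m' < m /\ four_squares (m' * p).
Proof.
move=> m1 ndvd [a [b [c [d e]]]].
have [|ka ha] := @nearest_multiple a m; first by lia.
have [|kb hb] := @nearest_multiple b m; first by lia.
have [|kc hc] := @nearest_multiple c m; first by lia.
have [|kd hd] := @nearest_multiple d m; first by lia.
set a' := a - m * ka in ha; set b' := b - m * kb in hb.
set c' := c - m * kc in hc; set d' := d - m * kd in hd.
pose m' := p - 2 * (a * ka + b * kb + c * kc + d * kd)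
  + m * (ka * ka + kb * kb + kc * kc + kd * kd).
have em : a' * a' + b' * b' + c' * c' + d' * d' = m * m'.
  have -> : a' * a' + b' * b' + c' * c' + d' * d' = (a * a + b * b + c * c + d * d)
    - m * (2 * (a * ka + b * kb + c * kc + d * kd)) +
    m * (m * (ka * ka + kb * kb + kc * kc + kd * kd)) by rewrite /a' /b' /c' /d'; ring.
  by rewrite -e /m'; ring.
have sq x : - m <= 2 * x < m -> 4 * (x * x) <= m * m /\ (4 * (x * x) = m * m -> 2 * x = - m).
  move=> /andP[h1 h2]; have h : 0 <= (m - 2 * x) * (m + 2 * x) by apply: mulr_ge0; lia.
  split=> [|e4]; first by lia.
  have : (m - 2 * x) * (m + 2 * x) == 0 by apply/eqP; lia.
  by rewrite mulf_eq0 => /orP[]/eqP; lia.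
have [sa qa] := sq _ ha; have [sb qb] := sq _ hb.
have [sc qc] := sq _ hc; have [sd qd] := sq _ hd.
exists m'; split; last first.
  (* Up to sign, [p - S], [B], [C], [D] are the coordinates of the quaternion product of the
     representation with the conjugate of its reduction, already divided by [m]. *)
  pose S := a * ka + b * kb + c * kc + d * kd.
  pose B := a * kb - b * ka + c * kd - d * kc.
  pose C := a * kc - c * ka + d * kb - b * kd.
  pose D := a * kd - d * ka + b * kc - c * kb.
  have eu : S * S + B * B + C * C + D * D =
      m * p * (ka * ka + kb * kb + kc * kc + kd * kd).
    by rewrite e /S /B /C /D; ring.
  exists (p - S), B, C, D.
  have -> : m' * p = p * p - 2 * p * S + m * p * (ka * ka + kb * kb + kc * kc + kd * kd).
    by rewrite /m' /S; ring.
  by rewrite -eu; ring.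
have sq0 (x : int) : 0 <= x * x by rewrite -expr2 sqr_ge0.
have mm0 : 0 < m by clear -m1; lia.
have [a0 b0 c0 d0] := And4 (sq0 a') (sq0 b') (sq0 c') (sq0 d').
have m'0 : 0 <= m' by rewrite -(pmulr_rge0 _ mm0) -em !addr_ge0.
have m'm : m' <= m.
  rewrite -(ler_pM2l mm0) -em; clear -sa sb sc sd.
  by move: (a' * a') (b' * b') (c' * c') (d' * d') (m * m) sa sb sc sd => *; lia.
(* If [m' = 0] all reduced coordinates vanish, and if [m' = m] all equal [- m / 2]; in both cases
   [m * m] divides [m * p], against [ndvd]. *)
have m'nz : m' != 0.
  apply/eqP => z; apply: ndvd; rewrite z mulr0 in em.
  have [za zb zc zd] : [/\ a' * a' == 0, b' * b' == 0, c' * c' == 0 & d' * d' == 0].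
    move: em a0 b0 c0 d0; move: (a' * a') (b' * b') (c' * c') (d' * d') => x y u t.
    by clear; split; lia.
  move: za zb zc zd; rewrite !mulf_eq0 !orbb => /eqP za /eqP zb /eqP zc /eqP zd.
  apply/dvdzP; exists (ka * ka + kb * kb + kc * kc + kd * kd).
  apply: (@mulfI _ m); first by clear -m1; lia.
  have [fa [fb [fc fd]]] : a = m * ka /\ b = m * kb /\ c = m * kc /\ d = m * kd.
    by clear -za zb zc zd; rewrite /a' /b' /c' /d' in za zb zc zd; lia.
  by rewrite e fa fb fc fd; ring.
have m'ne : m' != m.
  apply/eqP => z; apply: ndvd; rewrite z in em.
  have [ea eb ec ed] : [/\ 4 * (a' * a') = m * m, 4 * (b' * b') = m * m,
      4 * (c' * c') = m * m & 4 * (d' * d') = m * m].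
    move: em sa sb sc sd; move: (a' * a') (b' * b') (c' * c') (d' * d') (m * m) => x y t u v.
    by clear; split; lia.
  have za : 2 * a' = - m by apply: qa.
  have zb : 2 * b' = - m by apply: qb.
  have zc : 2 * c' = - m by apply: qc.
  have zd : 2 * d' = - m by apply: qd.
  apply/dvdzP; exists (ka * ka + kb * kb + kc * kc + kd * kd - ka - kb - kc - kd + 1).
  apply: (@mulfI _ (4 * m)); first by clear -m1; lia.
  have [fa [fb [fc fd]]] : 2 * a = m * (2 * ka - 1) /\ 2 * b = m * (2 * kb - 1) /\
      2 * c = m * (2 * kc - 1) /\ 2 * d = m * (2 * kd - 1).
    by clear -za zb zc zd; rewrite /a' /b' /c' /d' in za zb zc zd; lia.
  have -> : 4 * m * p = (2 * a) * (2 * a) + (2 * b) * (2 * b) + (2 * c) * (2 * c)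
    + (2 * d) * (2 * d) by rewrite -mulrA e; ring.
  by rewrite fa fb fc fd; ring.
by clear -m'0 m'm m'nz m'ne; lia.
Qed.

Lemma sqr_mod_inj (p h x y : nat) : prime p -> (p = h + h + 1)%N -> (x <= h)%N -> (y <= h)%N ->
  (x * x = y * y %[mod p])%N -> x = y.
Proof.
move=> pr ep; wlog xy : x y / (x <= y)%N => [hw hx hy e|hx hy /eqP].
  by case/orP: (leq_total x y) => le; [apply: hw|apply/esym/hw].
rewrite eq_sym eqn_mod_dvd ?leq_mul // => d.
have {d} : (p %| (y - x) * (y + x))%N.
  by rewrite mulnBl !mulnDr [(x * y)%N]mulnC subnDA addnK in d *.
rewrite Euclid_dvdM // => /orP[] /dvdn_leq; lia.
Qed.

(** With [h] the half of [p], the [h + 1] residues of squares and the [h + 1] residues of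
    [- 1 - y * y], written with [p * p] to stay non-negative, cannot all be distinct modulo [p]. *)
Lemma sum_two_squares_plus_one (p : nat) : prime p -> odd p ->
  exists x y m : nat, (x * x + y * y + 1 = m * p)%N /\ (0 < m < p)%N.
Proof.
move=> pr op; have ep : (p = p./2 + p./2 + 1)%N by rewrite addnn addn1 -{1}(odd_double_half p) op.
set h := p./2 in ep; have p0 : (0 < p)%N by apply: prime_gt0.
apply: contrapT => no.
pose f (u : 'I_h.+1 + 'I_h.+1) : 'I_p := match u with
  | inl x => Ordinal (ltn_pmod (x * x) p0)
  | inr y => Ordinal (ltn_pmod (p * p - 1 - y * y) p0) end.
have sm (y : 'I_h.+1) : (y * y + 1 <= p * p)%N.
  have : (y * y <= h * h)%N by apply: leq_mul; rewrite -ltnS.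
  by rewrite ep; nia.
have mixed (x y : 'I_h.+1) : (x * x = p * p - 1 - y * y %[mod p])%N -> False.
  move=> e; apply: no; exists (val x), (val y).
  have : (p %| x * x + y * y + 1)%N.
    rewrite /dvdn -addnA -modnDml e modnDml.
    have -> : (p * p - 1 - y * y + (y * y + 1) = p * p)%N by have := sm y; lia.
    by rewrite modnMl.
  move=> /dvdnP[m em]; exists m; split=> //.
  have : (x * x <= h * h)%N by apply: leq_mul; rewrite -ltnS.
  have : (y * y <= h * h)%N by apply: leq_mul; rewrite -ltnS.
  move: em; move: (x * x)%N (y * y)%N => a b em hb ha.
  apply/andP; split; first by case: m em => //; clear; lia.
  rewrite ltnNge; apply/negP => pm.
  have : (p * p <= m * p)%N by rewrite leq_mul2r pm orbT.
  have h0 : (0 < h)%N by have := prime_gt1 pr; rewrite {1}ep; clear; lia.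
  by rewrite -em ep; clear -ha hb h0; nia.
have injf : injective f.
  move=> [x|x] [y|y] [] // e.
  - by congr inl; apply: val_inj; apply: (sqr_mod_inj pr ep _ _ e); rewrite -ltnS.
  - by case: (mixed x y).
  - by case: (mixed y x).
  congr inr; apply: val_inj; apply: (sqr_mod_inj pr ep);
    [exact: (ltn_ord x)|exact: (ltn_ord y)|rewrite /=].
  have le (z : 'I_h.+1) : (z * z <= p * p - 1)%N.
    by have := sm z; move: (z * z)%N (p * p)%N => u v; clear; lia.
  have h1 : (x * x + (p * p - 1 - y * y) = p * p - 1 %[mod p])%N.
    by rewrite -modnDmr -e modnDmr subnKC //; apply: le.
  apply/eqP; rewrite -(eqn_modDr (p * p - 1 - y * y)) h1 subnKC //; apply: le.
by have := leq_card f injf; rewrite card_sum !card_ord [leqRHS]ep; clear; lia.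
Qed.

Lemma four_squares_prime (p : nat) : prime p -> four_squares p.
Proof.
move=> pr; have [e2|op] := even_prime pr; first by rewrite e2; exists 1, 1, 0, 0.
have [x [y [m [e /andP[m0 mp]]]]] := sum_two_squares_plus_one pr op.
have {e} : four_squares (m%:Z * p%:Z) by exists x%:Z, y%:Z, 1, 0; rewrite -PoszM -e; lia.
elim/ltn_ind: m m0 mp => m IH m0 mp h.
have [e1|m1] := eqVneq m 1%N; first by move: h; rewrite e1 mul1r.
have [||m' [/andP[m'0 m'm] h']] := @four_squares_descent m p _ _ h; first by lia.
  move=> d; have {}d : (m %| p)%N by [].
  by case/primeP: pr => _ /(_ _ d); clear -m1 mp; lia.
have em : m' = `|m'|%N by lia.
by rewrite em in h'; apply: IH h'; lia.
Qed.

Theorem lagrange (n : nat) : exists a b c d : nat, (n = a * a + b * b + c * c + d * d)%N.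
Proof.
suff [a [b [c [d e]]]] : four_squares n.
  exists `|a|%N, `|b|%N, `|c|%N, `|d|%N; clear -e; lia.
elim/ltn_ind: n => n IH; have [n1|n1] := leqP n 1.
  by exists n%:Z, 0, 0, 0; case: n n1 {IH} => [|[|]].
rewrite -(divnK (pdiv_dvd n)) PoszM; apply: four_squaresM.
  by apply: IH; rewrite ltn_Pdiv ?prime_gt1 ?pdiv_prime // ltnW.
by apply: four_squares_prime; apply: pdiv_prime.
Qed.

End FourSquares.

(** * Arithmetic in centralisers *)

Lemma derived_ker (G : groupType) (phi : G -> int) :
  {morph phi : x y / (x * y)%g >-> (x + y)%R} -> forall x, derived x -> phi x = 0%R.
Proof.
move=> hM; have h1 : phi 1%g = 0%R by have := hM 1%g 1%g; rewrite mulg1; lia.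
have hV x : phi x^-1%g = (- phi x)%R by have := hM x x^-1%g; rewrite mulgV h1; lia.
move=> x; elim=> {x} [//|x y|x y _ hx _ hy|x _ hx].
- by rewrite /commg /conjg !hM !hV; lia.
- by rewrite hM hx hy.
- by rewrite hV hx.
Qed.

Lemma morph_ab (G : groupType) (phi : G -> int) x y :
  {morph phi : x y / (x * y)%g >-> (x + y)%R} -> ab x = ab y -> phi x = phi y.
Proof.
move=> hM /abP/(derived_ker hM); rewrite hM.
have h1 : phi 1%g = 0%R by have := hM 1%g 1%g; rewrite mulg1; lia.
by have := hM x x^-1%g; rewrite mulgV h1; lia.
Qed.

Lemma morph_expg (G : groupType) (phi : G -> int) x n :
  {morph phi : x y / (x * y)%g >-> (x + y)%R} -> phi (x ^+ n)%g = (n%:Z * phi x)%R.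
Proof.
move=> hM; elim: n => [|n IH]; last by rewrite expgS hM IH -addn1 PoszD; ring.
by have := hM 1%g 1%g; rewrite mulg1 expg0; lia.
Qed.

Lemma rank2_characters (G : groupType) (m : nat) : torsion_free_rank G m -> 2 <= m ->
  exists (phi1 phi2 : G -> int) (a b : G),
    [/\ {morph phi1 : x y / (x * y)%g >-> (x + y)%R},
        {morph phi2 : x y / (x * y)%g >-> (x + y)%R} &
        [/\ phi1 a = 1%R, phi2 a = 0%R, phi1 b = 0%R & phi2 b = 1%R]].
Proof.
move=> [A [f [[finv fK finvK] fM]]] m2.
pose i1 : 'I_m := Ordinal (ltnW m2); pose i2 : 'I_m := Ordinal m2.
pose phi (i : 'I_m) (x : G) : int := (f (ab x)).1 ord0 i.
pose gen (i : 'I_m) : G := ab_repr (finv (delta_mx ord0 i, (f (ab 1%g)).2)).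
have phiM i : {morph phi i : x y / (x * y)%g >-> (x + y)%R}.
  by move=> x y; rewrite /phi -ab_mulE (fM (ab x) (ab y)) /= mxE.
have phig i j : phi i (gen j) = (i == j)%:R%R.
  by rewrite /phi /gen ab_reprK finvK /= mxE.
exists (phi i1), (phi i2), (gen i1), (gen i2); split=> //.
Qed.

(** Otherwise [u] and [c] would generate a subgroup Z^2. *)
Lemma centralizer_slope (G : groupType) (phi1 phi2 : G -> int) (u c : G) :
  hyperbolic G ->
  {morph phi1 : x y / (x * y)%g >-> (x + y)%R} ->
  {morph phi2 : x y / (x * y)%g >-> (x + y)%R} ->
  commute c u -> (phi1 u != 0 \/ phi2 u != 0)%R ->
  (phi1 u * phi2 c = phi2 u * phi1 c)%R.
Proof.
move=> hyp m1 m2 /commute_sym uc nz.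
have [i [j [i' [j' [ne e]]]]] := hyperbolic_no_Z2 hyp uc.
have := congr1 phi1 e; have := congr1 phi2 e; rewrite !m1 !m2 !morph_expg // => e2 e1.
(* If [j = j'], a non-zero multiple of the image of [u] would vanish. Otherwise both characters of
   [c] are the same rational multiple of those of [u]. *)
have jj : j != j'.
  apply/eqP => jj; case: (eqVneq i i') => [ii|ii]; first by rewrite ii jj eqxx in ne.
  rewrite jj in e1 e2.
  have z1 : ((i%:Z - i'%:Z) * phi1 u == 0)%R by apply/eqP; lia.
  have z2 : ((i%:Z - i'%:Z) * phi2 u == 0)%R by apply/eqP; lia.
  have ii' : ((i%:Z - i'%:Z) == 0)%R = false by lia.
  by move: z1 z2; rewrite !mulf_eq0 ii' /=; case: nz => /negbTE->.
apply: (@mulfI _ (j%:Z - j'%:Z)%R); first by lia.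
have h1 : ((j%:Z - j'%:Z) * phi1 c = (i'%:Z - i%:Z) * phi1 u)%R by lia.
have h2 : ((j%:Z - j'%:Z) * phi2 c = (i'%:Z - i%:Z) * phi2 u)%R by lia.
transitivity (phi1 u * ((j%:Z - j'%:Z) * phi2 c))%R; first by ring.
rewrite h2; transitivity (phi2 u * ((i'%:Z - i%:Z) * phi1 u))%R; first by ring.
by rewrite -h1; ring.
Qed.

Lemma ab_comm (G : groupType) (x y : G) : ab (x * y)%g = ab (y * x)%g.
Proof.
apply/abP; have -> : ((x * y)^-1 * (y * x) = [~ y, x])%g.
  by rewrite /commg /conjg invgM !mulgA.
exact: derivedR.
Qed.

Lemma ab_expgMn (G : groupType) (x y : G) n : ab ((x * y) ^+ n)%g = ab (x ^+ n * y ^+ n)%g.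
Proof.
have e z t : ab ((z * t)%g : G) = (ab z * ab t)%g by rewrite -ab_mulE.
have eX z : ab ((z ^+ n)%g : G) = (ab z ^+ n)%g.
  by elim: n => [//|k IH]; rewrite !expgS e IH.
by rewrite eX !e !eX expgMn // /commute -!e ab_comm.
Qed.

(** * Polynomial equations as systems over the group *)

HB.instance Definition _ := gen_eqMixin pexp.

Fixpoint zeval (p : pexp) (z : nat -> int) : int :=
  match p with
  | PVar i => z i
  | PCst c => Posz c
  | PAdd p q => (zeval p z + zeval q z)%R
  | PMul p q => (zeval p z * zeval q z)%R
  end.

(** Substituted for the variable [i], so that every integer solution yields natural numbers and, by
    [lagrange], every natural solution arises. *)
Definition sum_sq4 (i : nat) : pexp :=
  let sq r := PMul (PVar (4 * i + r)) (PVar (4 * i + r)) in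
  PAdd (PAdd (sq 0) (sq 1)) (PAdd (sq 2) (sq 3)).

Fixpoint psub (F : nat -> pexp) (p : pexp) : pexp :=
  match p with
  | PVar i => F i
  | PCst c => PCst c
  | PAdd p q => PAdd (psub F p) (psub F q)
  | PMul p q => PMul (psub F p) (psub F q)
  end.

Lemma peval_psub F p v : peval (psub F p) v = peval p (fun i => peval (F i) v).
Proof. by elim: p => //= p -> q ->. Qed.

Lemma zeval_psub F p z (x : nat -> nat) : (forall i, zeval (F i) z = Posz (x i)) ->
  zeval (psub F p) z = Posz (peval p x).
Proof. by move=> h; elim: p => //= p -> q ->; rewrite ?PoszD ?PoszM. Qed.

Lemma sum_sq4_nat (z : nat -> int) i : exists n : nat, zeval (sum_sq4 i) z = Posz n.
Proof.
exists `|zeval (sum_sq4 i) z|%N; rewrite gez0_abs //=.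
by rewrite !addr_ge0 // -expr2 sqr_ge0.
Qed.

Lemma sum_sq4_onto (x : nat -> nat) : exists z : nat -> nat,
  forall i, peval (sum_sq4 i) z = x i.
Proof.
have h i : exists f : nat -> nat, x i = f 0 * f 0 + f 1 * f 1 + (f 2 * f 2 + f 3 * f 3).
  have [a [b [c [d ->]]]] := lagrange (x i).
  by exists (nth 0 [:: a; b; c; d]) => /=; rewrite !addnA.
have [f hf] := choice h; exists (fun j => f (j %/ 4) (j %% 4)) => i /=.
by rewrite ![4 * i]mulnC !divnMDl // !modnMDl !divn_small // !modn_small // !addn0 -hf.
Qed.

Fixpoint subterms (p : pexp) : seq pexp :=
  p :: match p with PAdd q r | PMul q r => subterms q ++ subterms r | _ => [::] end.

Lemma subterms_refl p : p \in subterms p.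
Proof. by case: p => *; rewrite /= mem_head. Qed.

Lemma subterms_trans p q r : p \in subterms q -> q \in subterms r -> p \in subterms r.
Proof.
move=> pq; elim: r => [i|c|r1 IH1 r2 IH2|r1 IH1 r2 IH2].
- by rewrite /= inE => /eqP e; rewrite e in pq.
- by rewrite /= inE => /eqP e; rewrite e in pq.
- rewrite /= inE => /orP[/eqP e|]; first by rewrite e in pq.
  by rewrite mem_cat => /orP[/IH1|/IH2] h; rewrite inE mem_cat h ?orbT.
rewrite /= inE => /orP[/eqP e|]; first by rewrite e in pq.
by rewrite mem_cat => /orP[/IH1|/IH2] h; rewrite inE mem_cat h ?orbT.
Qed.

Definition subterm_closed (L : seq pexp) : Prop :=
  forall p q r, (p = PAdd q r \/ p = PMul q r) -> p \in L -> q \in L /\ r \in L.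

Lemma subterm_closed_flatten (ps : seq pexp) :
  subterm_closed (flatten [seq subterms p | p <- ps]).
Proof.
move=> p q r e /flattenP[_ /mapP[t tp ->] pt].
have [hq hr] : q \in subterms p /\ r \in subterms p.
  by case: e => ->; rewrite /= !inE !mem_cat !subterms_refl !orbT.
by split; apply/flattenP; exists (subterms t); rewrite ?map_f //; apply: subterms_trans pt.
Qed.

Definition wvar (n N j : nat) : equation n N.+1 := [:: (inr (inord j), false)].

Definition wcst (n N : nat) (w : word 'I_n) : equation n N.+1 := [seq (inl l.1, l.2) | l <- w].

Definition comm_eq (n k : nat) (u v : equation n k) : equation n k :=
  u ++ v ++ inv_word (v ++ u).

Definition same_eq (n k : nat) (u v : equation n k) : equation n k := inv_word u ++ v.

Definition wpow (A : Type) (w : word A) (c : nat) : word A := flatten (nseq c w).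

Lemma eval_wpow (A : Type) (H : groupType) (v : A -> H) w c :
  eval_word v (wpow w c) = (eval_word v w ^+ c)%g.
Proof.
elim: c => [|c IH]; first by rewrite /eval_word big_nil.
by rewrite expgS -IH -eval_word_cat.
Qed.

Lemma eval_eq_cat (H : groupType) n N (c : 'I_n -> H) (x : 'I_N.+1 -> H) u v :
  eval_equation c x (u ++ v) = (eval_equation c x u * eval_equation c x v)%g.
Proof. exact: eval_word_cat. Qed.

Lemma eval_wvar (H : groupType) n N (c : 'I_n -> H) (x : 'I_N.+1 -> H) j :
  eval_equation c x (wvar n N j) = x (inord j).
Proof. by rewrite /eval_equation /eval_word big_seq1. Qed.

Lemma eval_wcst (H : groupType) n N (c : 'I_n -> H) (x : 'I_N.+1 -> H) w :
  eval_equation c x (wcst N w) = eval_word c w.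
Proof. by rewrite /eval_equation /eval_word big_map. Qed.

Lemma eval_comm_eq (H : groupType) n N (c : 'I_n -> H) (x : 'I_N.+1 -> H) u v :
  eval_equation c x (comm_eq u v) = 1%g <->
  commute (eval_equation c x u) (eval_equation c x v).
Proof.
rewrite !eval_eq_cat /eval_equation eval_inv_word eval_word_cat mulgA.
by split=> [/eqP|->]; [rewrite mulg_eq1 invgK => /eqP|rewrite mulgV].
Qed.

Lemma eval_same_eq (H : groupType) n N (c : 'I_n -> H) (x : 'I_N.+1 -> H) u v :
  eval_equation c x (same_eq u v) = 1%g <->
  eval_equation c x u = eval_equation c x v.
Proof.
rewrite eval_eq_cat /eval_equation eval_inv_word.
by split=> [/eqP|->]; [rewrite mulg_eq1 => /eqP/invg_inj|rewrite mulVg].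
Qed.

Lemma solves_cons (H : groupType) n N (c : 'I_n -> H) (x : 'I_N.+1 -> H) w E :
  solves c x (w :: E) <-> eval_equation c x w = 1%g /\ solves c x E.
Proof.
split=> [h|[h1 h2] u]; last by rewrite inE => /orP[/eqP->|/h2].
by split=> [|u uE]; apply: h; rewrite inE ?eqxx ?uE ?orbT.
Qed.

Lemma solves_cat (H : groupType) n N (c : 'I_n -> H) (x : 'I_N.+1 -> H) E1 E2 :
  solves c x (E1 ++ E2) <-> solves c x E1 /\ solves c x E2.
Proof.
split=> [h|[h1 h2] u]; last by rewrite mem_cat => /orP[/h1|/h2].
by split=> u uE; apply: h; rewrite mem_cat uE ?orbT.
Qed.

Lemma solves_flatten (H : groupType) n N (c : 'I_n -> H) (x : 'I_N.+1 -> H)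
    (T : eqType) (L : seq T) (F : T -> seq (equation n N.+1)) :
  solves c x (flatten [seq F e | e <- L]) <-> forall e, e \in L -> solves c x (F e).
Proof.
split=> [h e eL u uF|h u /flattenP[_ /mapP[e eL ->]]]; last exact: h.
by apply: h; apply/flattenP; exists (F e) => //; apply: map_f.
Qed.

Lemma eval_ab (G : groupType) n N (c : 'I_n -> G) (x : 'I_N.+1 -> G) w :
  eval_equation (fun i => ab (c i)) (fun j => ab (x j)) w = ab (eval_equation c x w).
Proof.
rewrite /eval_equation /eval_word; elim: w => [|[l b] w IH]; first by rewrite !big_nil.
rewrite !big_cons IH; have e (y z : G) : ab (y * z)%g = (ab y * ab z)%g by rewrite -ab_mulE.
by rewrite e; congr (_ * _)%g; case: l b => [i|j] [] //=; rewrite -ab_invE.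
Qed.

(** An integer [k] is represented by an element [X] of the centraliser of [b]
    with [phi2 X = k]; [Y] in the centraliser of [a] has [phi1 Y = k], a fact
    enforced by [U] in the centraliser of [a * b].  For a product of [k] and
    [l], the image of the centraliser of [a * X] is spanned by [(1, k)], so
    that it contains [(l, k * l)]. *)
Definition enc_sol (G : groupType) (a b : G) (X Y U W : pexp -> G) (e : pexp) : Prop :=
  [/\ commute (X e) b, commute (Y e) a, commute (U e) (a * b)%g &
      ab (U e) = ab (Y e * X e)%g] /\
  match e with
  | PVar _ => True
  | PCst c => X e = (b ^+ c)%g
  | PAdd q r => X e = (X q * X r)%g
  | PMul q r => commute (W e) (a * X q)%g /\ ab (W e) = ab (Y r * X e)%g
  end.

(** The characters of [U e] are [phi1 (Y e)] and [phi2 (X e)], and commuting with [a * b] makes them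
    equal. Those of [W e] are [phi1 (Y r)] and [phi2 (X e)], and lie on the line through
    [(1, phi2 (X q))]. *)
Lemma enc_sound (G : groupType) (phi1 phi2 : G -> int) (a b : G) (X Y U W : pexp -> G)
    (L : seq pexp) :
  hyperbolic G ->
  {morph phi1 : x y / (x * y)%g >-> (x + y)%R} ->
  {morph phi2 : x y / (x * y)%g >-> (x + y)%R} ->
  phi1 a = 1%R -> phi2 a = 0%R -> phi1 b = 0%R -> phi2 b = 1%R ->
  subterm_closed L -> (forall e, e \in L -> enc_sol a b X Y U W e) ->
  forall e, e \in L -> phi2 (X e) = zeval e (fun i => phi2 (X (PVar i))).
Proof.
move=> hyp m1 m2 a1 a2 b1 b2 closed sol.
have slope u c := @centralizer_slope G phi1 phi2 u c hyp m1 m2.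
have base e : e \in L -> [/\ phi1 (X e) = 0%R, phi2 (Y e) = 0%R & phi1 (Y e) = phi2 (X e)].
  move=> /sol[[cX cY cU eU] _].
  have hX := slope b (X e) cX; have hY := slope a (Y e) cY; have hU := slope _ _ cU.
  have h1 := morph_ab m1 eU; have h2 := morph_ab m2 eU.
  rewrite !m1 !m2 a1 a2 b1 b2 in hX hY hU h1 h2.
  have {}hX := hX (or_intror isT); have {}hY := hY (or_introl isT).
  have {}hU := hU (or_introl isT).
  by split; lia.
elim=> [i|c|q IHq r IHr|q IHq r IHr] eL //=; have [_ he] := sol _ eL.
- by rewrite he morph_expg // b2; lia.
- have [qL rL] := closed _ q r (or_introl erefl) eL.
  by rewrite he m2 IHq // IHr.
have [qL rL] := closed _ q r (or_intror erefl) eL.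
have [cW eW] := he; rewrite -(IHq qL) -(IHr rL).
have [X1 _ _] := base _ eL; have [Xq1 _ _] := base _ qL; have [_ Yr2 Yr1] := base _ rL.
have hW := slope _ _ cW; have h1 := morph_ab m1 eW; have h2 := morph_ab m2 eW.
rewrite !m1 !m2 a1 a2 X1 Xq1 Yr1 Yr2 in hW h1 h2.
have {}hW := hW (or_introl isT).
move: hW; rewrite h1 h2; move: (phi2 _) (phi2 _) (phi2 _) => x y z; lia.
Qed.

Lemma enc_complete (G : groupType) (a b : G) (z : nat -> nat) (e : pexp) :
  enc_sol a b (fun e => b ^+ peval e z)%g (fun e => a ^+ peval e z)%g
    (fun e => (a * b) ^+ peval e z)%g
    (fun e => if e is PMul q r then (a * b ^+ peval q z) ^+ peval r z else 1)%g e.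
Proof.
split.
  split; last by rewrite ab_expgMn.
  - by apply: commute_sym; apply: commuteX.
  - by apply: commute_sym; apply: commuteX.
  - by apply: commute_sym; apply: commuteX.
case: e => [i|c|q r|q r] //=; first by rewrite expgnDr.
by split; [apply: commute_sym; apply: commuteX|rewrite ab_expgMn -expgnA].
Qed.

(** Variable 0 holds [b], variables 1 to 3 the numerals; then each subterm has a block of four, for
    [X], [Y], [U], [W]. *)
Definition xvar n N (L : seq pexp) (r : nat) (e : pexp) : equation n N.+1 :=
  wvar n N (4 + 4 * index e L + r).

Definition enc_eqs n N (wa wb : word 'I_n) (L : seq pexp) (e : pexp) :
    seq (equation n N.+1) :=
  let A := wcst N wa in let B := wcst N wb in let v := @xvar n N L in
  [:: comm_eq (v 0 e) B; comm_eq (v 1 e) A; comm_eq (v 2 e) (A ++ B)] ++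
  match e with
  | PVar _ => [::]
  | PCst c => [:: same_eq (v 0 e) (wpow B c)]
  | PAdd q r => [:: same_eq (v 0 e) (v 0 q ++ v 0 r)]
  | PMul q r => [:: comm_eq (v 3 e) (A ++ v 0 q)]
  end.

Definition enc_ab_eqs n N (L : seq pexp) (e : pexp) : seq (equation n N.+1) :=
  let v := @xvar n N L in
  same_eq (v 2 e) (v 1 e ++ v 0 e) ::
  if e is PMul q r then [:: same_eq (v 3 e) (v 1 r ++ v 0 e)] else [::].

Lemma enc_eqsP (G : groupType) n N (c : 'I_n -> G) (x : 'I_N.+1 -> G) wa wb L e :
  let v r e := x (inord (4 + 4 * index e L + r)) in
  solves c x (enc_eqs N wa wb L e) /\
    solves (fun i => ab (c i)) (fun j => ab (x j)) (enc_ab_eqs n N L e) <->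
  enc_sol (eval_word c wa) (eval_word c wb) (v 0) (v 1) (v 2) (v 3) e.
Proof.
move=> v; have eP w k : eval_equation c x (wpow w k) = (eval_equation c x w ^+ k)%g.
  exact: eval_wpow.
rewrite /enc_sol /enc_eqs /enc_ab_eqs solves_cat !solves_cons.
rewrite !eval_comm_eq !eval_same_eq !eval_ab !eval_eq_cat !eval_wcst !eval_wvar -/(v _ _).
split=> [[[[h1 [h2 [h3 _]]] h4] [h5 h6]]|[[h1 h2 h3 h5] h4]].
  split=> //; case: e h4 h6 {h1 h2 h3 h5} => [i|k|q r|q r] //.
  - by rewrite solves_cons eval_same_eq eP eval_wcst eval_wvar => -[].
  - by rewrite solves_cons eval_same_eq eval_eq_cat !eval_wvar => -[].
  rewrite !solves_cons eval_comm_eq eval_same_eq !eval_ab !eval_eq_cat !eval_wvar eval_wcst.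
  by move=> [? _] [? _].
split; last first.
  split=> //; case: e h4 {h1 h2 h3 h5} => [i|k|q r|q r] //.
  rewrite !solves_cons eval_same_eq !eval_ab !eval_eq_cat !eval_wvar.
  by move=> [_ h]; split.
split; first by do 3 split=> //.
case: e h4 {h1 h2 h3 h5} => [i|k|q r|q r] //.
- by rewrite solves_cons eval_same_eq eP eval_wcst eval_wvar => h; split.
- by rewrite solves_cons eval_same_eq eval_eq_cat !eval_wvar => h; split.
rewrite !solves_cons eval_comm_eq !eval_eq_cat !eval_wvar eval_wcst.
by move=> [h _]; split.
Qed.

(** The numeral is a power of variable 0 rather than of a word for [b]: its letters are then all
    equal, and the code does not depend on that word. *)
Definition num_eq n N (t k : nat) : equation n N.+1 :=
  same_eq (wvar n N t.+1) (wpow (wvar n N 0) k).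

Definition glob_eqs n N (wb : word 'I_n) (L : seq pexp) (p q : pexp) (t : nat -> pexp) :
    seq (equation n N.+1) :=
  [:: same_eq (wvar n N 0) (wcst N wb); same_eq (xvar n N L 0 p) (xvar n N L 0 q);
      same_eq (wvar n N 1) (xvar n N L 0 (t 0)); same_eq (wvar n N 2) (xvar n N L 0 (t 1));
      same_eq (wvar n N 3) (xvar n N L 0 (t 2))].

Lemma num_eqP (G : groupType) n N (c : 'I_n -> G) (x : 'I_N.+1 -> G) t k :
  eval_equation c x (num_eq n N t k) = 1%g <-> x (inord t.+1) = (x (inord 0) ^+ k)%g.
Proof.
have e : eval_equation c x (wpow (wvar n N 0) k) = (eval_equation c x (wvar n N 0) ^+ k)%g.
  exact: eval_wpow.
by rewrite eval_same_eq e !eval_wvar.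
Qed.

Lemma glob_eqsP (G : groupType) n N (c : 'I_n -> G) (x : 'I_N.+1 -> G) wb L p q t :
  let v e := x (inord (4 + 4 * index e L + 0)) in
  solves c x (glob_eqs N wb L p q t) <->
  [/\ x (inord 0) = eval_word c wb, v p = v q &
      [/\ x (inord 1) = v (t 0), x (inord 2) = v (t 1) & x (inord 3) = v (t 2)]].
Proof.
rewrite /glob_eqs !solves_cons !eval_same_eq !eval_wvar eval_wcst.
by split=> [[h1 [h2 [h3 [h4 [h5 _]]]]]|[h1 h2 [h3 h4 h5]]].
Qed.

(** The order of quantifiers matters: [rest] and [T] are fixed before the numerals, which the
    diagonal argument later replaces by the codes of these very systems. The variables [j], [j.+1],
    [j.+2] are the first parameters behind [j] unknowns. *)
Lemma encode_dp (G : groupType) (m : nat) n (s : n.-tuple G) (p q : pexp) (j : nat) :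
  hyperbolic G -> torsion_free_rank G m -> 2 <= m -> generates s ->
  exists N (rest T : seq (equation n N.+1)), 3 <= N /\ forall k0 k1 k2,
    dp_ab s (DPInstance ([:: num_eq n N 0 k0; num_eq n N 1 k1; num_eq n N 2 k2] ++ rest) T) <->
    exists x : nat -> nat,
      [/\ x j = k0, x j.+1 = k1, x j.+2 = k2 & peval p x = peval q x].
Proof.
move=> hyp rk m2 gen.
have [phi1 [phi2 [a [b [M1 M2 [a1 a2 b1 b2]]]]]] := rank2_characters rk m2.
have [wa ea] := gen a; have [wb eb] := gen b.
pose p' := psub sum_sq4 p; pose q' := psub sum_sq4 q; pose t i := sum_sq4 (j + i).
pose L := flatten [seq subterms e | e <- [:: p'; q'; t 0; t 1; t 2]].
have closed : subterm_closed L by apply: subterm_closed_flatten.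
have inL e : e \in [:: p'; q'; t 0; t 1; t 2] -> e \in L.
  by move=> h; apply/flattenP; exists (subterms e); [exact: map_f|exact: subterms_refl].
pose N := 3 + 4 * size L.
exists N, (glob_eqs N wb L p' q' t ++ flatten [seq enc_eqs N wa wb L e | e <- L]),
  (flatten [seq enc_ab_eqs n N L e | e <- L]); split=> // k0 k1 k2.
have unfold (g : N.+1.-tuple G) (v := fun r e => tnth g (inord (4 + 4 * index e L + r))) :
    (solves (tnth s) (tnth g) ([:: num_eq n N 0 k0; num_eq n N 1 k1; num_eq n N 2 k2] ++
      glob_eqs N wb L p' q' t ++ flatten [seq enc_eqs N wa wb L e | e <- L]) /\
     solves (fun i => ab (tnth s i)) (fun i => ab (tnth g i))
      (flatten [seq enc_ab_eqs n N L e | e <- L])) <->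
    [/\ tnth g (inord 0) = b, [/\ v 0 p' = v 0 q', v 0 (t 0) = (b ^+ k0)%g,
         v 0 (t 1) = (b ^+ k1)%g & v 0 (t 2) = (b ^+ k2)%g],
         [/\ tnth g (inord 1) = v 0 (t 0), tnth g (inord 2) = v 0 (t 1) &
             tnth g (inord 3) = v 0 (t 2)] &
     forall e, e \in L -> enc_sol a b (v 0) (v 1) (v 2) (v 3) e].
  have gP := glob_eqsP (tnth s) (tnth g) wb L p' q' t.
  move: (glob_eqs _ _ _ _ _ _) gP => GE gP.
  rewrite !solves_cat !solves_flatten !solves_cons !num_eqP gP -/(v 0 _) eb.
  have encP e := enc_eqsP (tnth s) (tnth g) wa wb L e; rewrite -/v ea eb in encP.
  split=> [[[[h0 [h1 [h2 _]]] [[gb gpq [g1 g2 g3]] gL]] gT]|[gb [gpq t0 t1 t2] [g1 g2 g3] gL]].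
    rewrite gb in h0 h1 h2; split=> //.
      by split; [exact: gpq|exact: etrans (esym g1) h0|exact: etrans (esym g2) h1|
        exact: etrans (esym g3) h2].
    by move=> e eL; apply/encP; split; [exact: gL|exact: gT].
  rewrite gb g1 g2 g3 t0 t1 t2; split; last by move=> e eL; have /encP[] := gL e eL.
  split; first by split=> //; split=> //; split.
  by split=> // e eL; have /encP[] := gL e eL.
split=> [[g]|[x [x0 x1 x2 epq]]].
  rewrite unfold => -[gb [epq t0 t1 t2] _ gL].
  pose v e := tnth g (inord (4 + 4 * index e L + 0)); pose z i := phi2 (v (PVar i)).
  have sound : forall e, e \in L -> phi2 (v e) = zeval e z.
    exact: enc_sound hyp M1 M2 a1 a2 b1 b2 closed gL.
  have [x hx] := choice (sum_sq4_nat z).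
  have tx i : t i \in [:: p'; q'; t 0; t 1; t 2] -> phi2 (v (t i)) = Posz (x (j + i)).
    by move=> /inL/sound; rewrite hx.
  exists x; split.
  - have := tx 0; rewrite /v t0 morph_expg // b2 addn0 !inE eqxx !orbT => /(_ isT); lia.
  - have := tx 1; rewrite /v t1 morph_expg // b2 addn1 !inE eqxx !orbT => /(_ isT); lia.
  - have := tx 2; rewrite /v t2 morph_expg // b2 addn2 !inE eqxx !orbT => /(_ isT); lia.
  have := congr1 phi2 epq; rewrite -/(v p') -/(v q') !sound ?inL ?inE ?eqxx ?orbT //.
  by rewrite !(zeval_psub _ hx) => -[].
have [z hz] := sum_sq4_onto x.
pose val e := peval e z.
pose gj (i : nat) : G :=
  if i is i'.+4 then
    let e := nth (PCst 0) L (i' %/ 4) in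
    match i' %% 4 with
    | 0 => b ^+ val e | 1 => a ^+ val e | 2 => (a * b) ^+ val e
    | _ => if e is PMul q r then (a * b ^+ val q) ^+ val r else 1
    end%g
  else (b ^+ nth 1%N [:: 1%N; k0; k1; k2] i)%g.
pose g : N.+1.-tuple G := [tuple gj i | i < N.+1].
have tg i : i <= N -> tnth g (inord i) = gj i.
  by move=> iN; rewrite tnth_mktuple inordK.
exists g; rewrite unfold.
have gL r e : r < 4 -> e \in L -> tnth g (inord (4 + 4 * index e L + r)) =
    match r with 0 => b ^+ val e | 1 => a ^+ val e | 2 => (a * b) ^+ val e
    | _ => if e is PMul q r then (a * b ^+ val q) ^+ val r else 1 end%g.
  move=> r4 eL; have iL : index e L < size L by rewrite index_mem.
  rewrite tg; last by rewrite /N; clear -r4 iL; lia.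
  rewrite -addnA /gj /= [4 * _]mulnC divnMDl // modnMDl divn_small // modn_small // addn0.
  by rewrite nth_index.
have vt i : t i \in L -> val (t i) = x (j + i) by rewrite /val hz.
have tL i : i < 3 -> t i \in L by case: i => [|[|[|]]] // _; apply: inL; rewrite !inE eqxx !orbT.
have [t0 t1 t2] := And3 (tL 0 isT) (tL 1 isT) (tL 2 isT).
split.
- by rewrite tg // /gj /= expg1.
- rewrite !gL // ?inL ?inE ?eqxx ?orbT //= !vt // addn0 addn1 addn2 x0 x1 x2; split=> //.
  rewrite /val /p' /q' !peval_psub.
  by have -> : (fun i => peval (sum_sq4 i) z) = x by [exact: funext]; rewrite epq.
- rewrite !gL // !vt // addn0 addn1 addn2 x0 x1 x2 !tg //.
move=> e eL; have := enc_complete a b z e.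
case: e eL => [i|c|q1 r1|q1 r1] eL.
- by rewrite /enc_sol !gL.
- by rewrite /enc_sol !gL.
- by have [h1 h2] := closed _ q1 r1 (or_introl erefl) eL; rewrite /enc_sol !gL.
- by have [h1 h2] := closed _ q1 r1 (or_intror erefl) eL; rewrite /enc_sol !gL.
Qed.

(** * The diagonal argument *)

Lemma prim_rec_functional (base : nat -> Prop) step :
  (forall y z, base y -> base z -> y = z) ->
  (forall j t y z, step j t y -> step j t z -> y = z) ->
  forall i y z, prim_rec base step i y -> prim_rec base step i z -> y = z.
Proof.
move=> hb hs; elim=> [|i IH] y z /=; first exact: hb.
by move=> [t [ht hy]] [u [hu hz]]; rewrite (IH _ _ ht hu) in hy; apply: hs hy hz.
Qed.

Lemma ra_eval_functional n (f : recalg n) v y z : ra_eval f v y -> ra_eval f v z -> y = z.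
Proof.
elim: f v y z => {n} [n|| n i|n k f IHf h IHh|n f IHf h IHh|n f IHf] v y z.
- by move=> -> ->.
- by move=> -> ->.
- by move=> -> ->.
- move=> [w [hw hy]] [w' [hw' hz]]; have e : w = w'.
    by apply: eq_from_tnth => i; apply: IHh (hw i) (hw' i).
  by apply: (IHf w y z) => //; rewrite e.
- by apply: prim_rec_functional => [a b|j t a b]; [apply: IHf|apply: IHh].
move=> [y0 ylt] [z0 zlt]; case: (ltngtP y z) => // [/zlt|/ylt] [u hu].
- by have := IHf _ _ _ y0 hu.
- by have := IHf _ _ _ z0 hu.
Qed.

Definition code_cons (x y : nat) : nat := 2 ^ x * (2 * y).+1.

Lemma code_cons_eq x l : CodeSeq.code (x :: l) = code_cons x (CodeSeq.code l).
Proof. by rewrite /code_cons mul2n. Qed.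

(** The geometric sum obtained by unfolding [CodeSeq.code]. *)
Definition code_nseq (l k : nat) : nat :=
  2 ^ l * ((2 ^ l.+1) ^ k - 1) %/ (2 ^ l.+1 - 1).

Lemma code_nseq_eq l k : CodeSeq.code (nseq k l) = code_nseq l k.
Proof.
have q2 : 1 < 2 ^ l.+1 by rewrite -{1}(expn0 2) ltn_exp2l.
have e : (2 ^ l.+1 - 1) * CodeSeq.code (nseq k l) = 2 ^ l * ((2 ^ l.+1) ^ k - 1).
  elim: k => [|k IH]; first by rewrite expn0 subnn !muln0.
  have -> : CodeSeq.code (nseq k.+1 l) = 2 ^ l.+1 * CodeSeq.code (nseq k l) + 2 ^ l.
    by rewrite /= -mul2n expnS; lia.
  rewrite mulnDr mulnCA IH (expnS _ k).
  have : 0 < (2 ^ l.+1) ^ k by rewrite expn_gt0 ltnW.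
  move: ((2 ^ l.+1) ^ k) => c; move: (2 ^ l.+1) (2 ^ l) q2 => q d q2 c0.
  case: c c0 => // c _; case: q q2 => // q _.
  have -> : q.+1 * c.+1 - 1 = q.+1 * c + q by rewrite mulnS; clear; lia.
  rewrite !subSS !subn0.
  by ring.
by rewrite /code_nseq -e mulKn // subn_gt0.
Qed.

(** The first letter is the inverse of variable [t.+1], contributed by [same_eq]; [k] copies of
    variable 0 follow. *)
Definition num_code (t k : nat) : nat :=
  code_cons (CodeSeq.code [:: 1; t.+1; 1]) (code_nseq (CodeSeq.code [:: 1; 0; 0]) k).

Lemma num_codeE n N t k : t < N ->
  CodeSeq.code [seq letter_code l | l <- num_eq n N t k] = num_code t k.
Proof.
move=> tN; rewrite /num_code -code_nseq_eq -code_cons_eq; congr CodeSeq.code.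
rewrite /num_eq /same_eq /= /letter_code /= inordK //; congr cons.
by elim: k => //= k ->; rewrite inordK.
Qed.

(** The code of the instance with [K] variables and systems [R] and [T], the
    numerals being set to [K], [R] and [T] themselves. *)
Definition diag_code (K R T : nat) : nat :=
  code_cons K (code_cons (code_cons (num_code 0 K) (code_cons (num_code 1 R)
    (code_cons (num_code 2 T) R))) (code_cons T 0)).

Lemma dfun_diag_code : dfun (fun v => diag_code (v 0) (v 1) (v 2)).
Proof.
have dc f g : dfun f -> dfun g -> dfun (fun v => code_cons (f v) (g v)).
  by move=> df dg; rewrite /code_cons; dio_tac.
have dn t f : dfun f -> dfun (fun v => num_code t (f v)).
  by move=> df; apply: dc; [exact: dfun_cst|rewrite /code_nseq; dio_tac].
rewrite /diag_code; repeat lazymatch goal with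
  | |- dfun (fun _ => code_cons _ _) => apply dc
  | |- dfun (fun _ => num_code _ _) => apply dn
  | |- _ => dio_step
  end.
Qed.

Lemma diag_codeE n N (rest T : seq (equation n N.+1)) : 3 <= N ->
  let R := system_code rest in let T' := system_code T in
  instance_code (DPInstance ([:: num_eq n N 0 N.+1; num_eq n N 1 R; num_eq n N 2 T'] ++ rest) T)
    = diag_code N.+1 R T'.
Proof.
move=> N3 R T'; rewrite /instance_code !code_cons_eq /=; congr (code_cons _ (code_cons _ _)).
have -> w0 w1 w2 : system_code [:: w0, w1, w2 & rest] =
  code_cons (CodeSeq.code [seq letter_code l | l <- w0])
    (code_cons (CodeSeq.code [seq letter_code l | l <- w1])
      (code_cons (CodeSeq.code [seq letter_code l | l <- w2]) R)).
  by rewrite -!code_cons_eq.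
by rewrite !num_codeE // ltnW // ltnW.
Qed.

Theorem theorem2 (G : groupType) (hyp : hyperbolic G)
  (m : nat) (rk : torsion_free_rank G m) (rk_ge2 : 2 <= m)
  (n : nat) (s : n.-tuple G) (gen : generates s) :
  ~ dp_ab_decidable s.
Proof.
move=> [f hf].
have [j [p [q P]]] : dio (fun v => ra_eval f [tuple diag_code (v 0) (v 1) (v 2) | _ < 1] 0).
  exact: (dio_recalg f (fun=> dfun_diag_code) (dfun_cst 0)).
have [N [rest [T [N3 enc]]]] := encode_dp p q j hyp rk rk_ge2 gen.
have {}enc := enc N.+1 (system_code rest) (system_code T).
have := hf _; move/(_ (DPInstance ([:: num_eq n N 0 N.+1; num_eq n N 1 (system_code rest);
  num_eq n N 2 (system_code T)] ++ rest) T)); rewrite enc diag_codeE //.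
set D := diag_code _ _ _.
have e : [tuple D | _ < 1] = [tuple D].
  by apply: eq_from_tnth => i; rewrite tnth_mktuple (ord1 i).
(* [P] has its parameters at positions 0, 1, 2; in the polynomials they stand behind the [j]
   unknowns. The instance is thus solvable exactly when [f] returns 0 on its code [D]. *)
have iff : (exists x : nat -> nat, [/\ x j = N.+1, x j.+1 = system_code rest,
    x j.+2 = system_code T & peval p x = peval q x]) <-> ra_eval f [tuple D] 0.
  split=> [[x [x0 x1 x2 epq]]|h0].
    have [_] := P (fun i => x (j + i)); rewrite addn0 addn1 addn2 x0 x1 x2 e; apply.
    exists x; have -> // : cat_env j x (fun i => x (j + i)) = x.
    by apply: funext => i; rewrite /cat_env; case: ltnP => // ji; rewrite subnKC.
  have [+ _] := P (nth 0 [:: N.+1; system_code rest; system_code T]).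
  rewrite /= -/D e => /(_ h0)[x epq].
  exists (cat_env j x (nth 0 [:: N.+1; system_code rest; system_code T])); split=> //.
  - by rewrite /cat_env ltnn subnn.
  - by rewrite /cat_env ltnNge leqnSn subSnn.
  - by rewrite /cat_env ltnNge leqW // -addn2 addKn.
rewrite iff => -[h1 h0]; have [h|h] := EM (ra_eval f [tuple D] 0).
  by have := ra_eval_functional (h1 h) h.
by apply: (h); apply: h0.
Qed.
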